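(* There exist universal constants $C_1,C_2>0$ such that the following holds for every constant $d\ge1$, every constant $\lambda\in\mathbb R$ with $|\lambda|\le\sqrt d$, and every constant $\varepsilon\ge C_1\left(\frac{C_2+\log d}{d}\right)^{1/3}$. Let $G\sim\mathrm{SBM}(n,d,\lambda)$. Then there is a deterministic sequence $\Delta=\Delta_n=o(\log n)$ such that, with probability $1-o_n(1)$ over $G$, the edge set $E(G)$ can be partitioned as $E(G)=E(G_1)\sqcup E(G_2)$ for graphs $G_1$ and $G_2$ on vertex set $[n]$ where: 1. the maximum degree of $G_1$ is at most $(1+\varepsilon)d$; 2. $G_2$ is a $(\Delta,D)$-pseudorandom near-forest with respect to $S:=V'(G_1)\cap V'(G_2)$, where $D=(1+\varepsilon)d$.
   Context: Stochastic block model $\mathrm{SBM}(n,d,\lambda)$: draw $\boldsymbol\sigma\in\{\pm1\}^n$ uniformly at random; given $\boldsymbol\sigma$, include each edge $uv$, $u\ne v\in[n]$, independently with probability $\frac{d+\lambda\sqrt d}{n}$ if $\boldsymbol\sigma(u)=\boldsymbol\sigma(v)$ and with probability $\frac{d-\lambda\sqrt d}{n}$ otherwise. For a graph $H$, $V'(H)$ is the set of non-isolated vertices of $H$. A graph is a near-forest if each of its connected components contains at most one cycle, equivalently each component $(V,E)$ has tree-excess $|E|-|V|+1\le1$. A graph $H$ is $(\Delta,D)$-pseudorandom with respect to $S\subseteq V(H)$ if: (i) for every $r\ge1$ and $u\in V(H)$, the number of vertices at distance at most $r$ from $u$ in $H$ is at most $D^{r-1}\Delta$; (ii) for every $r\ge0$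 and $u\in V(H)$, $|\{v\in S:\mathrm{dist}_H(u,v)\le r\}|\le D^r$. *)

(* Defs.v *)
From HB Require Import structures.
From mathcomp Require Import all_boot all_order all_algebra.
From mathcomp Require Import all_classical all_reals all_analysis.

Set Implicit Arguments.
Unset Strict Implicit.
Unset Printing Implicit Defensive.

Import Order.TTheory GRing.Theory Num.Theory.
Import numFieldNormedType.Exports.

Local Open Scope ring_scope.

(* An edge on the vertex set T is a 2-element subset of T, and a simple graph
   on T is a set of such edges.                                               *)
Notation edge T := {e : {set T} | #|e| == 2%N}.
Notation graph T := {set edge T}.

Section Graphs.
Variable T : finType.
Implicit Types (H : graph T) (u v : T) (c : seq T) (r k : nat) (S : {set T}).

Definition adj H : rel T := fun u v => [exists e in H, val e == [set u; v]%SET].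

Definition degree H u : nat := #|[set v | adj H u v]%SET|.

Definition max_degree H : nat := \max_(u : T) degree H u.

Definition non_isolated H : {set T} := [set u | [exists v, adj H u v]]%SET.

Definition has_walk H k u v : bool :=
  [exists p : k.-tuple T, path (adj H) u p && (last u p == v)].

(* The graph distance is the least length of a walk, None standing for
   infinity; shortest walks have length less than #|T|.                       *)
Definition gdist H u v : option nat :=
  ohead [seq k <- iota 0 #|T| | has_walk H k u v].

Definition gball H u r : {set T} :=
  [set v | if gdist H u v is Some k then (k <= r)%N else false]%SET.

Definition is_cycle H c : bool := (2 < size c)%N && ucycleb (adj H) c.

(* Two vertex sequences describe the same cycle when they traverse the same
   edges (so rotations and reversals are identified).                         *)
Definition cycle_edges c : {set {set T}} :=
  [set [set u; next c u] | u in c]%SET.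

Definition component H u : {set T} := [set v | connect (adj H) u v]%SET.

Definition near_forest H : Prop :=
  forall u c1 c2, is_cycle H c1 -> is_cycle H c2 ->
    {subset c1 <= component H u} -> {subset c2 <= component H u} ->
    cycle_edges c1 = cycle_edges c2.

Definition pseudorandom (R : realType) (Delta D : R) H S : Prop :=
  (forall r u, (1 <= r)%N -> #|gball H u r|%:R <= D ^+ (r - 1) * Delta) /\
  (forall r u, #|(S :&: gball H u r)%SET|%:R <= D ^+ r).

Lemma adj_sym H : symmetric (adj H).
Proof. by move=> u v; apply: eq_existsb => e; rewrite finset.setUC. Qed.

Lemma adj_irr H : irreflexive (adj H).
Proof.
move=> u; apply/negbTE/existsP => -[[e e2]] /andP[_ /eqP /= eu].
by move: e2; rewrite eu finset.setUid cards1.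
Qed.

Lemma gballP H u v r :
  reflect (exists p, [/\ path (adj H) u p, last u p = v & (size p <= r)%N])
          (v \in gball H u r).
Proof.
rewrite inE /gdist; set s := iota _ _.
apply: (iffP idP).
- case E: [seq k <- s | has_walk H k u v] => [//|k l] /= kr.
  have : k \in [seq k <- s | has_walk H k u v] by rewrite E mem_head.
  rewrite mem_filter => /andP[/existsP[p /andP[pp /eqP lp]] _].
  by exists p; rewrite size_tuple.
- move=> [p0 [pp lp sz]].
  have [p [pp' lp' szp ltT]] : exists p, [/\ path (adj H) u p, last u p = v,
      (size p <= r)%N & (size p < #|T|)%N].
    case/shortenP: pp lp => p pp' up sp lp; exists p; split => //.
      by apply: leq_trans sz; apply: uniq_leq_size => //; case/andP: up.
    by have := card_uniqP up => /= <-; apply: max_card.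
  have w : has_walk H (size p) u v.
    by apply/existsP; exists (in_tuple p); rewrite /= pp' lp' eqxx.
  have : size p \in [seq k <- s | has_walk H k u v].
    by rewrite mem_filter w mem_iota.
  have : sorted leq [seq k <- s | has_walk H k u v].
    by apply: sorted_filter (iota_sorted _ _); exact: leq_trans.
  case: [seq _ <- _ | _] => [//|k l] /= srt.
  rewrite inE => /orP[/eqP <- //|pl].
  have := order_path_min leq_trans srt => /allP /(_ _ pl) kp.
  exact: leq_trans kp szp.
Qed.

End Graphs.

Section StochasticBlockModel.
Variables (R : realType) (n : nat) (d lambda : R).

(* The two labels +1 and -1 are encoded by the booleans. *)
Definition labelling := {ffun 'I_n -> bool}.

Definition monochromatic (sigma : labelling) (e : edge 'I_n) : bool :=
  [forall u in val e, forall v in val e, sigma u == sigma v].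

(* For |lambda| <= sqrt d this lies in [0, 1] as soon as 2 d <= n; the finitely
   many smaller n play no role in the asymptotic statements.                  *)
Definition edge_prob (sigma : labelling) (e : edge 'I_n) : R :=
  (if monochromatic sigma e then d + lambda * Num.sqrt d
   else d - lambda * Num.sqrt d) / n%:R.

Definition sbm_joint_mass (sigma : labelling) (G : graph 'I_n) : R :=
  (2 ^+ n)^-1 *
  \prod_(e : edge 'I_n)
    (if e \in G then edge_prob sigma e else 1 - edge_prob sigma e).

Definition sbm_pr (A : graph 'I_n -> Prop) : R :=
  \sum_(sigma : labelling) \sum_(G : graph 'I_n | `[< A G >])
    sbm_joint_mass sigma G.

Lemma sbm_pr_true : sbm_pr (fun=> True) = 1.
Proof.
rewrite /sbm_pr /sbm_joint_mass.
under eq_bigr => sigma _.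
  under eq_bigl do rewrite asboolT //.
  rewrite -big_distrr /=.
  rewrite -(bigA_distr _ _ (edge_prob sigma) (fun e => 1 - edge_prob sigma e)).
  rewrite big1 ?mulr1 => [|e _]; last by rewrite [LHS]addrC subrK.
  over.
by rewrite sumr_const card_ffun card_bool card_ord -[_ *+ _]mulr_natl natrX divff.
Qed.

End StochasticBlockModel.

Definition good_decomposition (R : realType) (n : nat) (d eps Delta : R)
    (G : graph 'I_n) : Prop :=
  exists G1 G2 : graph 'I_n,
    [/\ G = (G1 :|: G2)%SET, [disjoint G1 & G2],
        (max_degree G1)%:R <= (1 + eps) * d,
        near_forest G2
      & pseudorandom Delta ((1 + eps) * d) G2
          (non_isolated G1 :&: non_isolated G2)%SET].

(* Main.v *)
(** Call a connected vertex set W heavy if the average over W of max(deg, b),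
    with b = (1 + eps/4) d, exceeds s = (1 + 3 eps/8) d.  Let X be the union of
    the heavy sets, G2 the set of edges touching X, and G1 the rest.

    A vertex y outside X lies in no heavy set; applied to the vertices of a
    shortest path from u to y, this bounds the product of the degrees along the
    path by (D - 1)^length (AM-GM), and at most M vertices can be reached from u
    by paths of a given length with degree product at most M.  This gives the
    growth bound for S, which is disjoint from X; singletons give the degree
    bound for G1.

    If G2 is not a near-forest, some component contains two cycles, so that it
    stays connected after deleting two edges e, f.  Either the endpoints of e and
    f are joined by short paths, and G contains a small connected set with two
    edges too many, or G2 contains a simple path P of order log n vertices.  At
    least about half of P lies in heavy sets, and a Vitali covering argument
    extracts disjoint heavy sets which together with P form a connected set with
    a linear excess of degrees.

    All bad events are therefore of the form "some connected set W has too many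
    edges or too large a degree sum", and are excluded by a first moment over
    spanning trees of W: for a tree with edge set F and A inside W, the
    exponential moment of the degree sum of A on the event that F is in G is
    bounded by (2 d e^(2 theta) / n)^|F| times exp (|A| d' (e^(2 theta) - 1) / 2),
    where d' bounds the expected degrees once the labels are nearly balanced.
    The same events at small scales bound the balls by D^(r-1) delta log n for
    every delta > 0, and a diagonal choice of delta gives Delta = o(log n). *)

Require Import Defs.
From mathcomp Require Import all_boot all_order all_algebra.
From mathcomp Require Import boolp reals sequences exp.
From mathcomp Require Import zify ring lra.

Set Implicit Arguments.
Unset Strict Implicit.
Unset Printing Implicit Defensive.

Import Order.TTheory GRing.Theory Num.Theory.

(** * Connected vertex sets, trees and coverings *)

Section Connectedness.
Variable V : finType.
Implicit Types (G H : graph V) (A J R W Y : {set V}) (u v w x y r : V).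

Definition induced H W : rel V := fun x y => [&& x \in W, y \in W & adj H x y].

Definition connected_set H W : Prop :=
  {in W &, forall x y, connect (induced H W) x y}.

Lemma adjE H (e : edge V) x y : e \in H -> val e = [set x; y] -> adj H x y.
Proof. by move=> eH ev; apply/existsP; exists e; rewrite eH ev eqxx. Qed.

Lemma adj_edge H x y :
  adj H x y -> exists2 e : edge V, e \in H & val e = [set x; y].
Proof. by case/existsP=> e /andP[eH /eqP ev]; exists e. Qed.

Lemma adj_sub G H : G \subset H -> subrel (adj G) (adj H).
Proof.
by move=> /subsetP GH x y /adj_edge[e eG]; apply: adjE; apply: GH.
Qed.

Lemma edgeP (e : edge V) : exists x y, x != y /\ val e = [set x; y].
Proof. by have /cards2P[x [y [xy ->]]] := valP e; exists x, y. Qed.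

Lemma edge_inj : injective (val : edge V -> {set V}).
Proof. exact: val_inj. Qed.

Lemma set2_eq x y z : [set x; y] = [set x; z] -> y = z.
Proof.
move=> E; have : y \in [set x; z] by rewrite -E !inE eqxx orbT.
have : z \in [set x; y] by rewrite E !inE eqxx orbT.
by rewrite !inE => /orP[/eqP->|/eqP->//] /orP[]/eqP.
Qed.

Lemma induced_sym H W : symmetric (induced H W).
Proof. by move=> x y; rewrite /induced adj_sym; case: (x \in W); case: (y \in W). Qed.

Lemma connect_induced_sym H W : connect_sym (induced H W).
Proof. exact: sym_connect_sym (induced_sym H W). Qed.

Lemma connect_induced_sub G H A W :
  A \subset W -> {in A &, subrel (adj G) (adj H)} ->
  subrel (connect (induced G A)) (connect (induced H W)).
Proof.
move=> /subsetP AW GH; apply: connect_sub => x y /and3P[xA yA xy].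
by apply: connect1; rewrite /induced !AW ?GH.
Qed.

Lemma connected_set_star H W r :
  {in W, forall x, connect (induced H W) r x} -> connected_set H W.
Proof.
move=> rW x y xW yW; apply: connect_trans (rW _ yW).
by rewrite connect_induced_sym rW.
Qed.

Lemma connected_set_sub G H W :
  {in W &, subrel (adj G) (adj H)} -> connected_set G W -> connected_set H W.
Proof.
by move=> GH cW x y xW yW; apply: connect_induced_sub (cW _ _ xW yW).
Qed.

Lemma connected_setU H A W x :
  x \in A -> x \in W -> connected_set H A -> connected_set H W ->
  connected_set H (A :|: W).
Proof.
move=> xA xW cA cW; apply: (@connected_set_star _ _ x) => y.
rewrite inE => /orP[yA|yW].
  by apply: connect_induced_sub (cA _ _ xA yA); rewrite ?subsetUl.
by apply: connect_induced_sub (cW _ _ xW yW); rewrite ?subsetUr.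
Qed.

Lemma path_connect_induced H W x p :
  path (adj H) x p -> {subset x :: p <= W} ->
  connect (induced H W) x (last x p).
Proof.
elim: p x => [|y p IH] x //= /andP[xy yp] pW.
apply: (@connect_trans _ _ y).
  by apply: connect1; rewrite /induced xy !pW ?inE ?eqxx ?orbT.
by apply: IH => // z zp; apply: pW; rewrite inE zp orbT.
Qed.

Lemma connected_path H x p :
  path (adj H) x p -> connected_set H [set y in x :: p].
Proof.
move=> xp; apply: (@connected_set_star _ _ x) => y; rewrite inE => yp.
case/splitPl: yp xp => p1 p2 <-; rewrite cat_path => /andP[xp1 _].
apply: path_connect_induced xp1 _ => z; rewrite !inE mem_cat.
by case/orP=> [->//|->]; rewrite orbT.
Qed.

Lemma connected_ball H u (r : nat) : connected_set H (gball H u r).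
Proof.
apply: (@connected_set_star _ _ u) => y /gballP[p [up <- pr]].
apply: path_connect_induced => // z zp.
case/splitPl: zp up pr => p1 p2 lp1; rewrite cat_path size_cat => /andP[up1 _] pr.
by apply/gballP; exists p1; split=> //; lia.
Qed.

Lemma gball0 H u : gball H u 0 = [set u].
Proof.
apply/setP => v; rewrite [in RHS]inE; apply/gballP/eqP => [[p [_ <-]]|->].
  by rewrite leqn0 size_eq0 => /eqP->.
by exists [::].
Qed.

(** A vertex of the larger ball ends a walk whose penultimate vertex lies in the smaller one; the
    extra 1 pays for [u], reached by the empty walk. *)
Lemma card_gballS H u (r : nat) :
  #|gball H u r.+1| <= (\sum_(y in gball H u r) degree H y).+1.
Proof.
have sub : gball H u r.+1 \subset
    u |: \bigcup_(y in gball H u r) [set v | adj H y v].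
  apply/subsetP => v /gballP[p [up <- pr]]; rewrite inE.
  case: p / lastP up pr => [|p z]; first by rewrite inE eqxx.
  rewrite rcons_path last_rcons size_rcons => /andP[up pz] pr.
  apply/orP; right; apply/bigcupP; exists (last u p); last by rewrite inE.
  by apply/gballP; exists p.
apply: leq_trans (subset_leq_card sub) _; rewrite cardsU1 -add1n.
apply: leq_add; first by case: (_ \notin _).
elim/big_rec2: _ => [|y n A _ le]; first by rewrite cards0.
by apply: leq_trans (leq_card_setU _ _) _; rewrite leq_add2l.
Qed.

Lemma connect_segment H W (s : seq V) x0 i j : i <= j ->
  (forall k, i <= k <= j -> nth x0 s k \in W) ->
  (forall k, i <= k < j -> adj H (nth x0 s k) (nth x0 s k.+1)) ->
  connect (induced H W) (nth x0 s i) (nth x0 s j).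
Proof.
move=> ij; rewrite -(subnKC ij); elim: (j - i) => [|m IH] W_ a_.
  by rewrite addn0.
apply: (@connect_trans _ _ (nth x0 s (i + m))).
  by apply: IH => k km; [apply: W_ | apply: a_]; lia.
apply: connect1; rewrite /induced addnS a_ ?W_ //; lia.
Qed.

(** Each vertex is sent to the next one on a shortest walk inside [W] to the root, so its distance
    [h] drops. If two vertices gave the same pair, each would be the parent of the other and [h]
    would drop both ways. The default [r] puts [f] in a function space with [#|W| ^ #|W|]
    elements. *)
Lemma spanning_tree H W r : r \in W -> connected_set H W ->
  exists f : {ffun V -> V},
    [/\ f \in pffun_on r W W, {in W :\ r, forall v, adj H v (f v)} &
        {in W :\ r &, injective (fun v => [set v; f v])}].
Proof.
move=> rW cW.
pose P v n := [exists p : n.-tuple V,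
  path (induced H W) v p && (last v p == r)].
have /fin_all_exists[h hP] : forall v, exists n,
    v \in W -> P v n /\ forall m, P v m -> n <= m.
  move=> v; case: (boolP (v \in W)) => [vW|]; last by exists 0.
  have : exists n, P v n.
    have /connectP[p vp lp] := cW _ _ vW rW.
    by exists (size p); apply/existsP; exists (in_tuple p); rewrite vp -lp eqxx.
  by case/ex_minnP => n Pn le; exists n.
have /fin_all_exists[f fP] : forall v, exists w,
    [/\ v \in W :\ r -> [/\ w \in W, adj H v w & h w < h v]
      & v \notin W :\ r -> w = r].
  move=> v; case: (boolP (v \in W :\ r)) => [|_]; last by exists r.
  rewrite !inE => /andP[vr vW]; have [/existsP[[p /= /eqP sp]] + _] := hP v vW.
  case: p sp => [|w p] /= sp; first by rewrite (negPf vr).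
  move=> /andP[/andP[/and3P[_ wW vw] wp] lp]; exists w; split=> // _; split=> //.
  rewrite -sp ltnS; have [_] := hP w wW; apply.
  by apply/existsP; exists (in_tuple p); rewrite wp.
exists [ffun v => f v]; split.
- apply/pffun_onP; split.
    apply/subsetP => v; rewrite !inE ffunE; apply: contraNT => vW.
    by apply/eqP; apply (fP v).2; rewrite !inE negb_and vW orbT.
  move=> _ /imageP[v vW ->]; rewrite ffunE.
  case: (boolP (v \in W :\ r)) => vr; first by case: ((fP v).1 vr).
  by rewrite (fP v).2.
- by move=> v vW; rewrite ffunE; case: ((fP v).1 vW).
move=> v w vW wW; rewrite !ffunE => E.
have [_ _ hv] := (fP v).1 vW; have [_ _ hw] := (fP w).1 wW.
have : v \in [set w; f w] by rewrite -E !inE eqxx.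
have : w \in [set v; f v] by rewrite E !inE eqxx.
rewrite !inE => /orP[/eqP->//|/eqP wfv] /orP[/eqP->//|/eqP vfw].
by move: hv hw; rewrite -wfv -vfw; lia.
Qed.

Definition tree_edges W r (f : {ffun V -> V}) : graph V :=
  [set e : edge V | [exists v in W :\ r, val e == [set v; f v]]].

Lemma tree_edges_sub H W r (f : {ffun V -> V}) :
  {in W :\ r, forall v, adj H v (f v)} -> tree_edges W r f \subset H.
Proof.
move=> fP; apply/subsetP => e; rewrite inE => /existsP[v /andP[vW /eqP ev]].
have /adj_edge[e' e'H ev'] := fP v vW.
by rewrite (_ : e = e') //; apply: val_inj; rewrite /= ev ev'.
Qed.

Lemma card_tree_edges H W r (f : {ffun V -> V}) : r \in W ->
  {in W :\ r, forall v, adj H v (f v)} ->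
  {in W :\ r &, injective (fun v => [set v; f v])} ->
  #|tree_edges W r f| = #|W|.-1.
Proof.
move=> rW fP fI; rewrite (cardsD1 r W) rW /=.
rewrite -(card_imset _ edge_inj) -(card_in_imset fI); apply: eq_card => s.
apply/imsetP/imsetP => [[e + ->]|[v vW ->]].
  by rewrite inE => /existsP[v /andP[vW /eqP ev]]; exists v.
have /adj_edge[e _ ev] := fP v vW; exists e => //.
by rewrite inE; apply/existsP; exists v; rewrite vW ev eqxx.
Qed.

(** Greedy choice: keep an index with a largest set, discard those whose sets meet it, and recurse
    on the rest. *)
Lemma vitali (I : finType) (Q : I -> {set V}) (Y : {set I}) :
  (forall i, i \in Y -> Q i != set0) ->
  exists2 J : {set I}, J \subset Y /\ {in J &, forall i j, i != j -> [disjoint Q i & Q j]}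
    & forall i, i \in Y -> exists j, [/\ j \in J, ~~ [disjoint Q i & Q j] & #|Q i| <= #|Q j|].
Proof.
have [m] := ubnP #|Y|; elim: m Y => // m IH Y Ym Q0.
have [->|[i0 i0Y]] := set_0Vmem Y.
  by exists set0 => [|i]; [rewrite sub0set; split=> // i j|]; rewrite inE.
case: (@arg_maxnP I i0 [in Y] (fun i => #|Q i|) i0Y) => i iY imax.
pose Y1 := [set j in Y | [disjoint Q j & Q i]].
have Y1Y : Y1 \subset Y by apply/subsetP => j; rewrite inE => /andP[].
have iY1 : i \notin Y1.
  by rewrite inE iY /= -setI_eq0 setIid Q0.
have [||J [/subsetP JY1 disJ] JP] := IH Y1.
- rewrite -ltnS; apply: leq_trans Ym; rewrite ltnS; apply/proper_card/properP; split=> //.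
  by exists i.
- by move=> j /(subsetP Y1Y)/Q0.
have dis_i j : j \in J -> [disjoint Q j & Q i].
  by move=> /JY1; rewrite inE => /andP[].
exists (i |: J).
  split; first by rewrite subUset sub1set iY; apply/subsetP => j /JY1/(subsetP Y1Y).
  move=> j k; rewrite !inE => /orP[/eqP->|jJ] /orP[/eqP->|kJ]; rewrite ?eqxx //.
  - by rewrite disjoint_sym dis_i.
  - by rewrite dis_i.
  exact: disJ.
move=> j jY; have [dji|dji] := boolP [disjoint Q j & Q i].
  have [|k [kJ djk le]] := JP j; first by rewrite inE jY.
  by exists k; rewrite inE kJ orbT.
by exists i; rewrite !inE eqxx; split=> //; apply: imax.
Qed.

Lemma leq_cardU A W (a b : nat) : #|A| <= a -> #|W| <= b -> #|A :|: W| <= a + b.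
Proof. by move=> Aa Wb; apply: leq_trans (leq_card_setU _ _) (leq_add Aa Wb). Qed.

(* The set W induces a subgraph of tree-excess at least 2, witnessed by two edges
   whose deletion leaves W connected. *)
Definition no_bicycle G (m : nat) : Prop :=
  forall W (e f : edge V), #|W| <= m -> e \in G -> f \in G -> e != f ->
    val e \subset W -> val f \subset W -> ~ connected_set (G :\ e :\ f) W.

Lemma gap_element n (N : {set 'I_n}) m : 0 < #|N| ->
  exists2 p : 'I_n, p \in N & #|N| <= m + #|[set q in N | p + m <= q]|.
Proof.
case/card_gt0P => p0 p0N.
case: (@arg_minnP 'I_n p0 [in N] (fun i => i : nat) p0N) => p pN pmin.
exists p => //; rewrite -(cardsID [set q : 'I_n | p + m <= q] N) addnC.
apply: leq_add; last first.
  by apply: subset_leq_card; apply/subsetP => q; rewrite !inE.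
rewrite cardE -(size_map val) -[leqRHS](size_iota p m); apply: uniq_leq_size.
  by rewrite (map_inj_uniq val_inj) enum_uniq.
move=> _ /mapP[q + ->]; rewrite mem_enum !inE mem_iota => /andP[pq qN].
by move: (pmin q qN) => /=; lia.
Qed.

Lemma gap_triple n (N : {set 'I_n}) m : 2 * m < #|N| ->
  exists p q r : 'I_n, [/\ p \in N, q \in N, r \in N, p + m <= q & q + m <= r].
Proof.
move=> Nm; have [|p pN le1] := @gap_element _ N m; first by lia.
have [|q] := @gap_element _ [set q in N | p + m <= q] m; first by lia.
rewrite inE => /andP[qN pq] le2.
have /card_gt0P[r] : 0 < #|[set r in [set q in N | p + m <= q] | q + m <= r]| by lia.
by rewrite !inE => /andP[/andP[rN _] qr]; exists p, q, r.
Qed.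

Lemma nth_set2_inj (P : seq V) x0 k l : uniq P -> k.+1 < size P -> l.+1 < size P ->
  [set nth x0 P k; nth x0 P k.+1] = [set nth x0 P l; nth x0 P l.+1] -> k = l.
Proof.
move=> uP kP lP E.
have : nth x0 P k \in [set nth x0 P l; nth x0 P l.+1] by rewrite -E !inE eqxx.
have : nth x0 P k.+1 \in [set nth x0 P l; nth x0 P l.+1] by rewrite -E !inE eqxx orbT.
rewrite !inE !nth_uniq ?(ltnW kP) ?(ltnW lP) //; lia.
Qed.

(** [R] is too small to contain all vertices from position [i] to [j - 1]. As position [i] is in
    [R], the vertex found outside has a predecessor on the stretch, and the edge between them is not
    contained in [R]. *)
Lemma leave_set (P : seq V) x0 R i j : uniq P -> j < size P -> i + #|R| < j ->
  nth x0 P i \in R -> exists2 s, i <= s /\ s.+1 < j & nth x0 P s.+1 \notin R.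
Proof.
move=> uP jP ij iR.
have [/allP all_in|/allPn[s]] := boolP (all (fun k => nth x0 P k \in R) (iota i (j - i))).
  have : size [seq nth x0 P k | k <- iota i (j - i)] <= size (enum R).
    apply: uniq_leq_size => [|_ /mapP[k kij ->]]; last by rewrite mem_enum all_in.
    rewrite map_inj_in_uniq ?iota_uniq // => k l; rewrite !mem_iota => kij lij /eqP.
    have [kP lP] : k < size P /\ l < size P by lia.
    by rewrite nth_uniq // => /eqP.
  by rewrite size_map size_iota -cardE; lia.
rewrite mem_iota => sij sR; case: s sij sR => [|s] sij sR.
  by move: sR; rewrite (_ : 0 = i) ?iR //; lia.
exists s => //; case: (ltngtP i s.+1) => [| |E]; [lia|lia|].
by move: sR; rewrite -E iR.
Qed.

(* Each of the two stretches of P between the three marked vertices leaves R, and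
   so contains an edge that can be deleted without disconnecting R and P. *)
Lemma far_triple G m (P : seq V) x0 R i1 i2 i3 :
  no_bicycle G m -> uniq P ->
  (forall k, k.+1 < size P -> adj G (nth x0 P k) (nth x0 P k.+1)) ->
  connected_set G R -> #|R| + size P <= m ->
  nth x0 P i1 \in R -> nth x0 P i2 \in R -> nth x0 P i3 \in R ->
  i1 + #|R| < i2 -> i2 + #|R| < i3 -> i3 < size P -> False.
Proof.
move=> nb uP aP cR Rm i1R i2R i3R i12 i23 i3P.
have [|s [i1s si] sR] := leave_set uP _ i12 i1R; first by lia.
have [t [i2t ti] tR] := leave_set uP i3P i23 i2R.
have [sP tP] : s.+1 < size P /\ t.+1 < size P by lia.
have [e1 e1G ve1] := adj_edge (aP s sP).
have [e2 e2G ve2] := adj_edge (aP t tP).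
have e12 : e1 != e2.
  apply/eqP => E; suff : s = t by lia.
  by apply: (nth_set2_inj (x0 := x0) uP sP tP); rewrite -ve1 -ve2 E.
pose H := G :\ e1 :\ e2; pose T := R :|: [set y in P].
have RT : R \subset T by apply: subsetUl.
have PT k : k < size P -> nth x0 P k \in T.
  by move=> kP; rewrite !inE mem_nth ?orbT.
(* Both deleted edges have an endpoint outside [R], so [R] stays connected. *)
have subR : {in R &, subrel (adj G) (adj H)}.
  move=> x y xR yR /adj_edge[e eG ve]; apply: (@adjE _ e) => //.
  rewrite !inE eG andbT; apply/andP; split; apply/eqP => E.
    by have : nth x0 P t.+1 \in val e; [rewrite E ve2 !inE eqxx orbT|
      rewrite ve !inE => /orP[]/eqP E'; move: tR; rewrite E' ?xR ?yR].
  by have : nth x0 P s.+1 \in val e; [rewrite E ve1 !inE eqxx orbT|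
    rewrite ve !inE => /orP[]/eqP E'; move: sR; rewrite E' ?xR ?yR].
have aH k : k.+1 < size P -> k != s -> k != t -> adj H (nth x0 P k) (nth x0 P k.+1).
  move=> kP ks kt; have [e eG ve] := adj_edge (aP k kP); apply: (@adjE _ e) => //.
  rewrite !inE eG andbT; apply/andP; split; apply/eqP => E.
    by case/eqP: kt; apply: (nth_set2_inj (x0 := x0) uP kP tP); rewrite -ve -ve2 E.
  by case/eqP: ks; apply: (nth_set2_inj (x0 := x0) uP kP sP); rewrite -ve -ve1 E.
have conR x y : x \in R -> y \in R -> connect (induced H T) x y.
  by move=> xR yR; apply: connect_induced_sub (cR x y xR yR).
apply: (nb T e1 e2) => //.
- apply: leq_trans (leq_card_setU _ _) _; apply: leq_trans Rm; rewrite leq_add2l.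
  by rewrite cardsE; apply: card_size.
- by rewrite ve1 subUset !sub1set (PT _ sP) (PT _ (ltnW sP)).
- by rewrite ve2 subUset !sub1set (PT _ tP) (PT _ (ltnW tP)).
apply: (@connected_set_star _ _ (nth x0 P i1)) => y; rewrite inE => /orP[yR|].
  exact: conR.
rewrite inE => /(nthP x0)[j jP <-].
have seg k l : k <= l -> l < size P -> (l <= s) || (s < k) -> (l <= t) || (t < k) ->
    connect (induced H T) (nth x0 P k) (nth x0 P l).
  move=> kl lP sl tl; apply: connect_segment => // z /andP[kz zl].
    exact/PT/(leq_ltn_trans zl).
  apply: aH; first exact: leq_ltn_trans zl lP.
    by move: sl kz zl; clear; lia.
  by move: tl kz zl; clear; lia.
have symc := connect_induced_sym H T.
have [i1P i2P] : i1 < size P /\ i2 < size P by move: i12 i23 i3P; clear; lia.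
(* The two deleted edges cut [P] into three stretches, each containing one of the marked vertices of
   [R]. *)
have [js|js] := leqP j s.
  by case/orP: (leq_total i1 j) => ij; [|rewrite symc]; apply: seg => //;
    move: js ij i1s si i2t; clear; lia.
have [jt|jt] := leqP j t.
  apply: connect_trans (conR _ _ i1R i2R) _.
  by case/orP: (leq_total i2 j) => ij; [|rewrite symc]; apply: seg => //;
    move: js jt ij si i2t; clear; lia.
apply: connect_trans (conR _ _ i1R i3R) _.
by case/orP: (leq_total i3 j) => ij; [|rewrite symc]; apply: seg => //;
  move: js jt ij si i2t ti; clear; lia.
Qed.

(* If more than 10 |Q j| vertices w of P had their set Q w meeting the same larger
   Q j, three of them would be far apart along P compared to the union of these
   sets, contradicting far_triple. *)
Lemma vitali_path G K (P : seq V) x0 Y (Q : V -> {set V}) :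
  no_bicycle G (5 * K) -> uniq P -> size P <= K ->
  (forall k, k.+1 < size P -> adj G (nth x0 P k) (nth x0 P k.+1)) ->
  Y \subset [set y in P] ->
  {in Y, forall w, [/\ w \in Q w, connected_set G (Q w) & #|Q w| <= K]} ->
  exists J : {set V}, [/\ J \subset Y,
    {in J &, forall i j, i != j -> [disjoint Q i & Q j]} &
    #|Y| <= 10 * \sum_(j in J) #|Q j|].
Proof.
move=> nb uP PK aP /subsetP YP QP.
have [w wY|J [JY disJ] JP] := @vitali V Q Y.
  by apply/set0Pn; exists w; case: (QP w wY).
exists J; split=> //.
have hit w : {j | w \in Y -> [/\ j \in J, ~~ [disjoint Q w & Q j] & #|Q w| <= #|Q j|]}.
  have [wY|_] := boolP (w \in Y); last by exists w.
  pose B j := [&& j \in J, ~~ [disjoint Q w & Q j] & #|Q w| <= #|Q j|].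
  case: (pickP B) => [j /and3P[*]|B0]; first by exists j.
  exfalso; have [j [jJ dj le]] := JP w wY.
  by have := B0 j; rewrite /B jJ dj le.
pose h w := sval (hit w).
have hP w (wY : w \in Y) := svalP (hit w) wY.
rewrite -sum1_card (partition_big h (mem J)) /=; last by move=> w /hP[].
rewrite big_distrr /=; apply: leq_sum => j jJ; rewrite sum1_card.
have jY : j \in Y by apply: (subsetP JY).
have [jQ cj jK] := QP j jY.
have Qj0 : 0 < #|Q j| by apply/card_gt0P; exists j.
rewrite leqNgt; apply/negP => big.
pose Yj := [set w in Y | h w == j].
have {}big : 10 * #|Q j| < #|Yj| by rewrite cardsE; apply: big.
pose N := [set i : 'I_(size P) | nth x0 P i \in Yj].
have NY : #|Yj| <= #|N|.
  rewrite -(card_in_imset (f := fun i : 'I_(size P) => nth x0 P i)).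
    apply/subset_leq_card/subsetP => w wYj; have := wYj.
    rewrite inE => /andP[/YP + _]; rewrite inE => /(nthP x0)[i iP iw].
    by apply/imsetP; exists (Ordinal iP); [rewrite [_ \in N]inE /= iw | rewrite /= iw].
  move=> i k _ _ /eqP; rewrite nth_uniq // => /eqP ik; exact: val_inj.
(* The gap exceeds [4 * #|Q j|], which bounds the union of [Q j] and three sets meeting it. Finding
   the triple requires [8 * #|Q j| + 2 < #|N|]; this follows from [10 * #|Q j| < #|N|] as [Q j] is
   nonempty. *)
have [|p [q [r [pN qN rN pq qr]]]] := @gap_triple _ N (4 * #|Q j|).+1.
  by apply: leq_trans NY; apply: leq_trans big; move: Qj0; clear; lia.
have inY (i : 'I_(size P)) : i \in N -> let w := nth x0 P i in
    [/\ w \in Q w, connected_set G (Q w), ~~ [disjoint Q w & Q j] & #|Q w| <= #|Q j|].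
  rewrite !inE => /andP[wY /eqP hw].
  by have [] := QP _ wY; have [] := hP _ wY; rewrite -/(h _) hw.
have glue W w : connected_set G W -> Q j \subset W -> connected_set G (Q w) ->
    ~~ [disjoint Q w & Q j] -> connected_set G (Q w :|: W).
  move=> cW jW cw /pred0Pn[x /andP[/= xw xj]].
  by apply: (connected_setU (x := x)) => //; apply: (subsetP jW).
pose wp := nth x0 P p; pose wq := nth x0 P q; pose wr := nth x0 P r.
have [pQ cp dp lp] : [/\ wp \in Q wp, connected_set G (Q wp),
  ~~ [disjoint Q wp & Q j] & #|Q wp| <= #|Q j|] := inY p pN.
have [qQ cq dq lq] : [/\ wq \in Q wq, connected_set G (Q wq),
  ~~ [disjoint Q wq & Q j] & #|Q wq| <= #|Q j|] := inY q qN.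
have [rQ cr dr lr] : [/\ wr \in Q wr, connected_set G (Q wr),
  ~~ [disjoint Q wr & Q j] & #|Q wr| <= #|Q j|] := inY r rN.
pose R := Q wp :|: (Q wq :|: (Q wr :|: Q j)).
have cR : connected_set G R.
  apply: (glue) => //; last by rewrite !subsetU ?subxx ?orbT.
  apply: (glue) => //; last by rewrite !subsetU ?subxx ?orbT.
  exact: glue.
have Rle : #|R| <= 4 * #|Q j|.
  rewrite (_ : 4 * _ = #|Q j| + (#|Q j| + (#|Q j| + #|Q j|))); last by clear; lia.
  exact: (leq_cardU lp (leq_cardU lq (leq_cardU lr (leqnn _)))).
have jK5 : #|R| + size P <= 5 * K by move: Rle jK PK; clear; lia.
apply: (far_triple (i1 := p) (i2 := q) (i3 := r) nb uP aP cR jK5) => //.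
- by rewrite inE pQ.
- by rewrite !inE qQ !orbT.
- by rewrite !inE rQ !orbT.
- by move: Rle pq; clear; lia.
- by move: Rle qr; clear; lia.
Qed.

End Connectedness.

(** * Near-forests *)

Section NearForests.
Variable V : finType.
Implicit Types (G H : graph V) (W : {set V}) (u v w x y : V).

Lemma path_avoid H (e : edge V) v w q : v \in val e -> v \notin w :: q ->
  path (adj H) w q -> path (adj (H :\ e)) w q.
Proof.
move=> ve; elim: q w => //= z q IH w vq /andP[wz zq]; apply/andP; split.
  have [e' e'H e'v] := adj_edge wz; apply: (@adjE _ _ e') => //.
  rewrite !inE e'H andbT; apply: contraNneq vq => E.
  by move: ve; rewrite -E e'v !inE => /orP[]->; rewrite ?orbT.
by apply: IH => //; move: vq; rewrite inE negb_or => /andP[].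
Qed.

(** The rest of the cycle joins the two endpoints. After a rotation the cycle reads [u], [v], [w]
    and so on; the step from [v] to [w] is treated apart because [path_avoid] applies only from [w]
    on, where [v] no longer occurs. *)
Lemma cycle_edge_reroute H c (e : edge V) x y :
  is_cycle H c -> val e \in cycle_edges c -> val e = [set x; y] ->
  connect (adj (H :\ e)) x y.
Proof.
move=> /andP[sc /andP[cc uc]] /imsetP[u uc' eu] exy.
suff con : connect (adj (H :\ e)) (next c u) u.
  have symc := sym_connect_sym (@adj_sym _ (H :\ e)).
  have xE : x \in [set u; next c u] by rewrite -eu exy !inE eqxx.
  have yE : y \in [set u; next c u] by rewrite -eu exy !inE eqxx orbT.
  by move: xE yE; rewrite !inE => /orP[]/eqP-> /orP[]/eqP-> //; rewrite symc.
case: (rot_to uc') => i q Eq.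
rewrite -(next_rot i uc) Eq; rewrite -(next_rot i uc) Eq in eu.
rewrite -(rot_uniq i) Eq in uc; rewrite -(rot_cycle i) Eq in cc.
rewrite -(size_rot i) Eq in sc.
case: q {Eq} => [|v [|w q]] // in uc cc sc eu *.
rewrite /= eqxx /= in eu *; move: cc uc => /= /and3P[uv vw wq] /andP[uq /andP[vq _]].
apply: (@connect_trans _ _ w).
  apply: connect1; have [e' e'H e'v] := adj_edge vw; apply: (@adjE _ _ e') => //.
  rewrite !inE e'H andbT; apply: contraNneq uq => E.
  have : u \in val e' by rewrite E [val e]eu !inE eqxx.
  by rewrite e'v !inE => /orP[]->; rewrite ?orbT.
apply/connectP; exists (rcons q u); last by rewrite last_rcons.
apply: (@path_avoid _ _ v) => //; first by rewrite [val e]eu !inE eqxx orbT.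
move: uq vq; rewrite !inE mem_rcons !inE !negb_or => /and3P[uv' _ _] /andP[-> ->].
by rewrite eq_sym uv'.
Qed.

Lemma is_cycle_del H c (e : edge V) :
  is_cycle H c -> val e \notin cycle_edges c -> is_cycle (H :\ e) c.
Proof.
move=> /andP[sc /andP[cc uc]] ec; rewrite /is_cycle sc /= /ucycleb uc andbT.
apply: cycle_from_next => // x xc.
have [e' e'H e'v] := adj_edge (next_cycle cc xc); apply: (@adjE _ _ e') => //.
rewrite !inE e'H andbT; apply: contraNneq ec => <-.
by rewrite e'v; apply/imsetP; exists x.
Qed.

Lemma cycle_edgeP H c s : is_cycle H c -> s \in cycle_edges c ->
  exists2 e : edge V, e \in H & val e = s.
Proof.
move=> /andP[_ /andP[cc _]] /imsetP[u uc ->].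
exact: adj_edge (next_cycle cc uc).
Qed.

Lemma cycle_edge_sub (c : seq V) s : s \in cycle_edges c -> {subset s <= c}.
Proof.
move=> /imsetP[u uc ->] v; rewrite !inE => /orP[]/eqP-> //.
by rewrite mem_next.
Qed.

Lemma connect_set_path H x y : connect (adj H) x y ->
  exists x0 p, [/\ path (adj H) x0 p, uniq (x0 :: p), x \in x0 :: p & y \in x0 :: p].
Proof.
case/connectP => p xp ->; case/shortenP: xp => q xq uq _.
by exists x, q; rewrite mem_head mem_last.
Qed.

(** Let [e] be an edge of [c1] outside [c2], and [f] any edge of [c2]. The cycle [c2] survives the
    deletion of [e] and reconnects the ends of [f]; then [c1] reconnects the ends of [e], so the
    component stays connected without both. Simple paths joining the ends of [e], the ends of [f],
    and [e] to [f] have at most [K] vertices each, and their union is a forbidden bicycle. *)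
Lemma no_two_cycles G H K c1 c2 u (s : {set V}) :
  H \subset G -> no_bicycle G (3 * K) ->
  (forall x p, path (adj H) x p -> uniq (x :: p) -> size p < K) ->
  is_cycle H c1 -> is_cycle H c2 ->
  {subset c1 <= component H u} -> {subset c2 <= component H u} ->
  s \in cycle_edges c1 -> s \notin cycle_edges c2 -> False.
Proof.
move=> HG nb short C1 C2 c1u c2u s1 s2.
have [e eH es] := cycle_edgeP C1 s1; rewrite -{}es in s1 s2.
have [t t2] : exists t, t \in cycle_edges c2.
  have [+ _] := andP C2; case Ec: c2 => [//|z c] _.
  by exists [set z; next c2 z]; rewrite -Ec; apply/imsetP; exists z; rewrite // Ec mem_head.
have [f fH ft] := cycle_edgeP C2 t2; rewrite -{}ft in t2.
have ef : e != f by apply: contraNneq s2 => ->.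
have [a [b [ab eE]]] := edgeP e; have [a' [b' [ab' fE]]] := edgeP f.
pose H2 := H :\ e :\ f.
have symc := sym_connect_sym (@adj_sym _ H2).
have con_f : connect (adj H2) a' b'.
  by apply: cycle_edge_reroute t2 fE; apply: is_cycle_del.
have sub1 : subrel (connect (adj (H :\ e))) (connect (adj H2)).
  apply: connect_sub => x y /adj_edge[g gH gE].
  have [gf|gf] := eqVneq g f.
    have xE : x \in val f by rewrite -gf gE !inE eqxx.
    have yE : y \in val f by rewrite -gf gE !inE eqxx orbT.
    by move: xE yE; rewrite fE !inE => /orP[]/eqP-> /orP[]/eqP-> //; rewrite symc.
  by apply/connect1/(adjE (e := g)) => //; rewrite !inE gf; rewrite !inE in gH.
have con_e : connect (adj H2) a b by apply: sub1; apply: cycle_edge_reroute s1 eE.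
have sub2 : subrel (connect (adj H)) (connect (adj H2)).
  apply: connect_sub => x y /adj_edge[g gH gE].
  have [ge|ge] := eqVneq g e.
    have xE : x \in val e by rewrite -ge gE !inE eqxx.
    have yE : y \in val e by rewrite -ge gE !inE eqxx orbT.
    by move: xE yE; rewrite eE !inE => /orP[]/eqP-> /orP[]/eqP-> //; rewrite symc.
  by apply/sub1/connect1/(adjE (e := g)) => //; rewrite !inE ge.
have con_aa : connect (adj H2) a a'.
  have ua : connect (adj H) u a.
    have : a \in component H u by apply/c1u/(cycle_edge_sub s1); rewrite eE !inE eqxx.
    by rewrite inE.
  have ua' : connect (adj H) u a'.
    have : a' \in component H u by apply/c2u/(cycle_edge_sub t2); rewrite fE !inE eqxx.
    by rewrite inE.
  by apply: (connect_trans (y := u)); [rewrite symc|]; apply: sub2.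
have H2H : subrel (adj H2) (adj H).
  by apply/adj_sub/(subset_trans (subsetDl _ _))/subsetDl.
have H2G : {in setT &, subrel (adj H2) (adj (G :\ e :\ f))}.
  by move=> x y _ _; apply: adj_sub; apply/setSD/setSD.
have seg x y : connect (adj H2) x y -> exists2 W : {set V},
    connected_set H2 W & [/\ x \in W, y \in W & #|W| <= K].
  move=> /connect_set_path[x0 [p [xp up xin yin]]].
  exists [set z in x0 :: p]; first exact: connected_path.
  rewrite !inE -!in_cons; split=> //.
  rewrite cardsE; apply: leq_trans (card_size _) _.
  by apply: short up; apply: sub_path xp.
have [W1 cW1 [aW1 bW1 kW1]] := seg _ _ con_e.
have [W2 cW2 [aW2 bW2 kW2]] := seg _ _ con_f.
have [W3 cW3 [aW3 bW3 kW3]] := seg _ _ con_aa.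
apply: (nb (W1 :|: (W3 :|: W2)) e f) => //.
- rewrite (_ : 3 * K = K + (K + K)); last by clear; lia.
  exact: (leq_cardU kW1 (leq_cardU kW3 kW2)).
- exact: (subsetP HG).
- exact: (subsetP HG).
- by rewrite eE subUset !sub1set !inE aW1 bW1.
- by rewrite fE subUset !sub1set !inE aW2 bW2 !orbT.
apply: (connected_set_sub (G := H2)); first by move=> x y _ _; apply: H2G.
apply: (connected_setU (x := a)) => //; first by rewrite inE aW3.
exact: (connected_setU (x := a')).
Qed.

Lemma near_forest_of_short_paths G H K :
  H \subset G -> no_bicycle G (3 * K) ->
  (forall x p, path (adj H) x p -> uniq (x :: p) -> size p < K) ->
  near_forest H.
Proof.
move=> HG nb short u c1 c2 C1 C2 c1u c2u; apply/setP => s.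
by apply/idP/idP => sc; apply: contraT => sn; exfalso;
  [apply: (no_two_cycles HG nb short C1 C2 c1u c2u sc sn) |
   apply: (no_two_cycles HG nb short C2 C1 c2u c1u sc sn)].
Qed.

End NearForests.

Local Open Scope ring_scope.

(** * The splitting of a graph *)

Section Splitting.
Variables (V : finType) (R : realFieldType).
Implicit Types (G H : graph V) (A W X : {set V}) (b s D M : R).

(** The cap is from below: factors of at least [b] can be divided by, and dropping one from a
    product gains a factor [b]. *)
Definition capped_degree b G x : R := Num.max (degree G x)%:R b.

Definition heavy b s G w : Prop := exists W : {set V},
  [/\ w \in W, connected_set G W & s * #|W|%:R < \sum_(x in W) capped_degree b G x].

Definition heavy_set b s G : {set V} := [set w | `[< heavy b s G w >]]%SET.

Definition touching X G : graph V := [set e in G | ~~ [disjoint val e & X]]%SET.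

(** The endpoint is left out of the product because a step offers as many choices as the degree of
    the vertex it leaves. *)
Definition reach_le b G M u k : {set V} :=
  [set y | `[< exists p, [/\ path (adj G) u p, last u p = y, size p = k &
    \prod_(x <- belast u p) capped_degree b G x <= M] >]]%SET.

Lemma leq_card_bigcup (I : finType) (P : pred I) (F : I -> {set V}) :
  (#|\bigcup_(i | P i) F i| <= \sum_(i | P i) #|F i|)%N.
Proof.
elim/big_rec2: _ => [|i n A _ le]; first by rewrite cards0.
by apply: leq_trans (leq_card_setU _ _) _; rewrite leq_add2l.
Qed.

(* Induction on k: the step from u to one of its neighbours divides M by at least
   the number of choices. *)
Lemma card_reach_le b G M u k : 0 < b -> 0 <= M -> #|reach_le b G M u k|%:R <= M.
Proof.
move=> b0; elim: k u M => [|k IH] u M M0.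
  have [M1|M1] := leP 1 M.
    apply: le_trans M1; rewrite -[leRHS]/1%:R ler_nat -(cards1 u).
    apply/subset_leq_card/subsetP => y; rewrite !inE => /asboolP[p [_ <- sp _]].
    by case: p sp.
  rewrite (_ : reach_le _ _ _ _ _ = set0) ?cards0 //.
  apply/setP => y; rewrite !inE; apply/asboolP => -[p [_ _ sp]].
  by case: p sp => // _; rewrite big_nil leNgt M1.
have w0 x : 0 < capped_degree b G x by rewrite lt_max b0 orbT.
have M'0 : 0 <= M / capped_degree b G u by rewrite divr_ge0 // ltW.
pose S v := reach_le b G (M / capped_degree b G u) v k.
have sub : reach_le b G M u k.+1 \subset \bigcup_(v in [set v | adj G u v]) S v.
  apply/subsetP => y; rewrite inE => /asboolP[[|v p] [//= /andP[uv vp] lp [sp] le]].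
  apply/bigcupP; exists v; rewrite ?inE //.
  apply/asboolP; exists p; split=> //.
  by rewrite ler_pdivlMr // mulrC; rewrite big_cons in le.
apply: (@le_trans _ _ (\sum_(v in [set v | adj G u v]) #|S v|%:R)).
  by rewrite -natr_sum ler_nat; apply: leq_trans (subset_leq_card sub) (leq_card_bigcup _ _).
apply: (@le_trans _ _ (\sum_(v in [set v | adj G u v]) M / capped_degree b G u)).
  by apply: ler_sum => v _; apply: IH.
rewrite sumr_const -mulr_natl mulrCA ler_piMr // ler_pdivrMr // mul1r.
by rewrite le_max lexx.
Qed.

Lemma prod_le_mean b s G (q : seq V) : uniq q -> 0 < b ->
  \sum_(x <- q) capped_degree b G x <= s * (size q)%:R ->
  \prod_(x <- q) capped_degree b G x <= s ^+ size q.
Proof.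
move=> uq b0 le.
have w0 x : 0 <= capped_degree b G x by rewrite le_max (ltW b0) orbT.
have [q0|q0] := posnP (size q).
  by rewrite q0; move/size0nil: q0 => ->; rewrite big_nil.
rewrite big_uniq //=.
have [+ _] := leif_AGM (A := mem q) (E := capped_degree b G) (fun x _ => w0 x).
move/card_uniqP: (uq) => ->; move=> AGM; apply: le_trans AGM _.
rewrite lerXn2r ?nnegrE //.
- by rewrite divr_ge0 // sumr_ge0.
- have : 0 <= s * (size q)%:R by apply: le_trans le; rewrite sumr_ge0.
  by rewrite pmulr_lge0 ?ltr0n.
by rewrite ler_pdivrMr ?ltr0n //; rewrite -big_uniq.
Qed.

(** The vertices of the path form a connected set containing its last vertex, so the mean over them
    is at most [s] and the product at most [s ^+ (size p).+1]. Dropping the last factor gains [b],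
    and [s ^+ 2 <= b * (D - 1)] together with [s <= D - 1] turns the rest into powers of [D - 1]. *)
Lemma not_heavy_prod b s D G u p :
  0 < b -> b <= s -> s ^+ 2 <= b * (D - 1) -> ~ heavy b s G (last u p) ->
  path (adj G) u p -> uniq (u :: p) ->
  \prod_(x <- belast u p) capped_degree b G x <= (D - 1) ^+ size p.
Proof.
move=> b0 bs sD nh up uq.
case: p nh up uq => [|v p] nh up uq; first by rewrite big_nil.
set q := v :: p in nh up uq *.
have w0 x : 0 < capped_degree b G x by rewrite lt_max b0 orbT.
have s0 : 0 < s by apply: lt_le_trans bs.
have le : \prod_(x <- u :: q) capped_degree b G x <= s ^+ (size q).+1.
  apply: prod_le_mean => //; rewrite leNgt; apply/negP => lt; apply: nh.
  exists [set y in u :: q]; split.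
  - by rewrite inE mem_last.
  - exact: connected_path.
  by rewrite cardsE (card_uniqP uq) (eq_bigl _ _ (fun x => in_set _ x)) -big_uniq.
move: le; rewrite lastI big_rcons /=.
set P := \prod_(x <- _) _ => le.
have P0 : 0 <= P by apply: prodr_ge0 => x _; apply: ltW.
have : P * b <= s ^+ (size q).+1.
  by apply: le_trans le; rewrite ler_wpM2l // le_max lexx orbT.
rewrite -ler_pdivlMr // => Pb; apply: le_trans Pb _.
rewrite ler_pdivrMr //.
have D1 : 0 <= D - 1.
  by rewrite -(pmulr_rge0 _ b0); apply: le_trans sD; rewrite exprn_ge0 // ltW.
have sD' : s <= D - 1.
  rewrite -(ler_pM2l b0); apply: le_trans sD.
  by rewrite expr2 ler_pM2r.
rewrite /q /=; elim: (size p) => [|m IH]; first by rewrite mulrC expr1.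
rewrite exprSr [X in _ <= X * _]exprSr [leRHS]mulrAC.
have s0' := ltW s0; exact: (ler_pM (exprn_ge0 m.+2 s0') s0' IH sD').
Qed.

(* The subset A makes room for counting only the vertices of large degree. *)
Definition sparse_excess G (K : nat) b (kappa : R) : Prop :=
  forall W A, connected_set G W -> (K <= #|W|)%N -> A \subset W ->
    \sum_(x in A) (degree G x)%:R < b * #|A|%:R + kappa * #|W|%:R.

(** The increment [D ^+ r.+1 - D ^+ r = (D - 1) * D ^+ r] is at least the new term. *)
Lemma sum_powers_le D r : 1 <= D ->
  \sum_(j < r.+1) (D - 1) ^+ j <= D ^+ r.
Proof.
move=> D1; have D0 : 0 <= D - 1 by rewrite subr_ge0.
elim: r => [|r IH]; first by rewrite big_ord_recl big_ord0 addr0 !expr0.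
rewrite big_ord_recr /=; apply: le_trans (lerD IH (lexx _)) _.
rewrite -lerBrDl [leRHS](_ : _ = (D - 1) * D ^+ r); last by rewrite exprS; ring.
rewrite exprS.
by apply: ler_wpM2l => //; apply: lerXn2r; rewrite ?nnegrE ?lerBlDr ?lerDl //; lra.
Qed.

(** Only vertices of degree above [b] lift [capped_degree] above [b], so the whole excess sits on
    them. *)
Lemma excess_heavy b s G W :
  s * #|W|%:R < \sum_(x in W) capped_degree b G x ->
  (s - b) * #|W|%:R <
    \sum_(x in [set x in W | b < (degree G x)%:R]) ((degree G x)%:R - b).
Proof.
rewrite mulrBl ltrBlDr => lt; apply: lt_le_trans lt _.
rewrite mulr_natr -sumr_const.
under [X in _ <= X + _]eq_bigl do rewrite inE.
rewrite [X in _ <= X + _]big_mkcondr -big_split /=.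
apply: ler_sum => x xW; case: ltP => h; rewrite ge_max ?subrK ?lexx ?add0r ?lexx ?andbT //.
exact: ltW.
Qed.

Lemma sparse_excessB G K b kappa W A : sparse_excess G K b kappa ->
  connected_set G W -> (K <= #|W|)%N -> A \subset W ->
  \sum_(x in A) ((degree G x)%:R - b) < kappa * #|W|%:R.
Proof.
move=> E2 cW KW AW; rewrite big_split /= sumrN sumr_const.
by rewrite ltrBlDl -[b *+ _]mulr_natr; apply: E2.
Qed.

(** In a heavy set with [K] or more vertices, those of degree above [b] would be a subset
    contradicting [sparse_excess]. *)
Lemma heavy_small b s kappa G K W : kappa <= s - b ->
  sparse_excess G K b kappa -> connected_set G W ->
  s * #|W|%:R < \sum_(x in W) capped_degree b G x -> (#|W| < K)%N.
Proof.
move=> ks E2 cW /excess_heavy; rewrite ltnNge => lt; apply/negP => KW.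
have := sparse_excessB E2 cW KW (subsetDl _ [set x | ~~ (b < (degree G x)%:R)]).
rewrite (_ : _ :\: _ = [set x in W | b < (degree G x)%:R]); last first.
  by apply/setP => x; rewrite !inE negbK andbC.
by move/(lt_trans lt)/lt_geF/negP; apply; rewrite ler_wpM2r.
Qed.

(** Cut the path into consecutive pairs: each is an edge and so has a vertex in [X]. At most one
    vertex is left over, whence the length [size p] on the left. *)
Lemma path_count_half X x p :
  path (fun y z => (y \in X) || (z \in X)) x p ->
  (size p <= 2 * count [in X] (x :: p))%N.
Proof.
have [m] := ubnP (size p); elim: m x p => // m IH x [|y [|z p]] //= sp.
  by rewrite andbT => /orP[]->; clear; lia.
move=> /and3P[xy _ zp]; have := IH z p _ zp; rewrite /= => /(_ _)/wrap[]; first by move: sp; clear; lia.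
by case/orP: xy => ->; clear; lia.
Qed.

Lemma card_setI_count X (P : seq V) : uniq P ->
  #|X :&: [set y in P]%SET| = count [in X] P.
Proof.
move=> uP; rewrite -size_filter -(card_uniqP (filter_uniq _ uP)).
by apply: eq_card => y; rewrite !inE mem_filter.
Qed.

Lemma touching_adj X G x y : adj (touching X G) x y ->
  adj G x y /\ ((x \in X) || (y \in X)).
Proof.
move=> /adj_edge[e + ve]; rewrite inE ve => /andP[eG /pred0Pn[z /andP[zxy zX]]].
split; first exact: adjE ve.
have : z \in [set x; y] := zxy; have {}zX : z \in X := zX.
by rewrite !inE => /orP[]/eqP <-; rewrite zX ?orbT.
Qed.

(** Among the first [K] vertices of the path about half lie in heavy sets, each of fewer than [K]
    vertices. Disjoint ones of total size [L] are selected, whose union with the path is a connected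
    [W] with [#|W| <= 22 * L]. They alone carry a degree excess of at least [(s - b) * L], hence at
    least [kappa * #|W|], against [sparse_excess]. *)
Lemma no_long_path b s kappa G K x p :
  b < s -> (1 < K)%N -> kappa <= (s - b) / 22 -> sparse_excess G K b kappa ->
  no_bicycle G (5 * K) ->
  path (adj (touching (heavy_set b s G) G)) x p -> uniq (x :: p) -> (size p < K)%N.
Proof.
move=> bs K1 ks E2 nb xp up; rewrite ltnNge; apply/negP => Kp.
set X := heavy_set b s G in xp *.
pose q := take K.-1 p.
have sq : size (x :: q) = K by rewrite /= size_takel; move: K1 Kp; clear; lia.
have uq : uniq (x :: q).
  by have := take_uniq K up; rewrite -{1}(prednK (ltnW K1)).
have xq : path (adj (touching X G)) x q.
  by move: xp; rewrite -(cat_take_drop K.-1 p) cat_path => /andP[].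
have xqG : path (adj G) x q by apply: sub_path xq => y z /touching_adj[].
pose Y := X :&: [set y in x :: q].
have KY : (K <= (2 * #|Y|).+1)%N.
  rewrite card_setI_count // -sq ltnS; apply: path_count_half.
  by apply: sub_path xq => y z /touching_adj[].
have sb : 0 < s - b by rewrite subr_gt0.
have ks' : kappa <= s - b by apply: le_trans ks _; rewrite ler_pdivrMr //; lra.
have [Q QP] : exists Q : V -> {set V}, forall w, w \in X ->
    [/\ w \in Q w, connected_set G (Q w) & s * #|Q w|%:R < \sum_(y in Q w) capped_degree b G y].
  apply: (@fin_all_exists V _ (fun w (W : {set V}) => w \in X ->
    [/\ w \in W, connected_set G W & s * #|W|%:R < \sum_(y in W) capped_degree b G y])).
  move=> w; have [wX|] := boolP (w \in X); last by exists set0.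
  by move: (wX); rewrite inE => /asboolP[W WP]; exists W.
have QK w : w \in X -> (#|Q w| < K)%N.
  by move=> /QP[_ cw hw]; apply: heavy_small ks' E2 cw hw.
have [|||w wY|J [JY disJ YJ]] := @vitali_path V G K (x :: q) x Y Q nb uq.
- by rewrite sq.
- by move=> k; move/(pathP x): xqG => xqG; apply: xqG.
- exact: subsetIr.
- have wX : w \in X by apply: (subsetP (subsetIl _ _) _ wY).
  by case: (QP w wX) => ? ? _; split=> //; apply/ltnW/QK.
have JX j : j \in J -> j \in X by move=> /(subsetP JY)/(subsetP (subsetIl _ _)).
(* Empty sets outside [J] make the family disjoint over all indices. *)
pose F j := if j \in J then Q j else set0.
have disF i j : i != j -> [disjoint F i & F j].
  rewrite /F -setI_eq0; case: ifP => iJ ij; last by rewrite set0I.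
  by case: ifP => jJ; [rewrite setI_eq0 disJ | rewrite setI0].
pose U := \bigcup_j F j.
pose A := [set y in U | b < (degree G y)%:R].
pose W := [set y in x :: q] :|: U.
pose L := (\sum_(j in J) #|Q j|)%N.
have cardU : #|U| = L.
  rewrite -sum1_card /U (partition_disjoint_bigcup _ _ disF) [LHS](bigID [in J]) /= [X in (_ + X)%N]big1 ?addn0.
    by apply: eq_bigr => j jJ; rewrite /F jJ sum1_card.
  by move=> j /negPf jJ; rewrite /F jJ big_set0.
have L0 : (0 < L)%N by move: KY YJ K1; rewrite -/L; clear; lia.
(* The path contributes [K <= 2 * #|Y| + 1 <= 20 * L + 1], the heavy sets contribute [L], and
   [1 <= L]. *)
have WL : (#|W| <= 22 * L)%N.
  apply: (leq_trans (leq_card_setU _ _)); rewrite cardU cardsE.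
  apply: leq_trans (leq_add (card_size _) (leqnn _)) _.
  by rewrite sq; move: KY YJ L0; rewrite -/L; clear; lia.
have idG (B : {set V}) : {in B &, subrel (adj G) (adj G)} by move=> ? ? _ _.
have cP : connected_set G [set y in x :: q] by apply: connected_path.
have xP : x \in [set y in x :: q] by rewrite inE mem_head.
have cW : connected_set G W.
  apply: (@connected_set_star _ _ _ x) => y; rewrite inE => /orP[yq|/bigcupP[j _]].
    by apply: (connect_induced_sub (subsetUl _ _) (@idG _)); apply: cP.
  rewrite /F; case: ifP => [jJ yQ|_]; last by rewrite inE.
  have [jQ cj _] := QP j (JX j jJ).
  have jq : j \in [set y in x :: q] by case/setIP: (subsetP JY j jJ).
  apply: (@connect_trans _ _ j).
    by apply: (connect_induced_sub (subsetUl _ _) (@idG _)); apply: cP.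
  apply: (connect_induced_sub _ (@idG _)) (cj _ _ jQ yQ).
  apply: subset_trans (subsetUr _ _); apply: subset_trans (bigcup_sup j _) => //.
  by rewrite /F jJ.
have KW : (K <= #|W|)%N.
  rewrite -sq -(card_uniqP uq) -(cardsE [in x :: q]).
  by apply: subset_leq_card; apply: subsetUl.
have AW : A \subset W.
  by apply/subsetP => y; rewrite !inE => /andP[-> _]; rewrite orbT.
have := sparse_excessB E2 cW KW AW.
suff : (s - b) * L%:R <= \sum_(y in A) ((degree G y)%:R - b).
  move=> le1 /(le_lt_trans le1); apply/negP; rewrite -leNgt.
  apply: (@le_trans _ _ ((s - b) / 22 * #|W|%:R)); first by rewrite ler_wpM2r.
  rewrite -mulrA ler_pM2l // mulrC ler_pdivrMr // -natrM ler_nat.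
  by move: WL; clear; lia.
have AE (y : V) : (y \in A) = (y \in U) && (b < (degree G y)%:R) by rewrite inE.
rewrite (eq_bigl _ _ AE) /U big_mkcondr /= (partition_disjoint_bigcup _ _ disF) /=.
rewrite /L natr_sum mulr_sumr big_mkcond /=; apply: ler_sum => j _.
rewrite /F; case: ifP => jJ; last by rewrite big_set0.
have [_ _ /excess_heavy/ltW] := QP j (JX j jJ); move/le_trans; apply.
under [leLHS]eq_bigl do rewrite inE.
by rewrite big_mkcondr.
Qed.

Lemma gball_sub G H u (r : nat) : H \subset G -> gball H u r \subset gball G u r.
Proof.
move=> HG; apply/subsetP => v /gballP[p [up lp sp]]; apply/gballP; exists p.
by split=> //; apply: sub_path up; apply: adj_sub.
Qed.

Lemma gball_reach b s D G H (S : {set V}) u (r : nat) :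
  0 < b -> b <= s -> s ^+ 2 <= b * (D - 1) -> H \subset G ->
  {in S, forall y, ~ heavy b s G y} ->
  S :&: gball H u r \subset \bigcup_(j < r.+1) reach_le b G ((D - 1) ^+ j) u j.
Proof.
move=> b0 bs sD HG SX; apply/subsetP => y /setIP[yS /gballP[p [up lp pr]]].
have {}up : path (adj G) u p by apply: sub_path up; apply: adj_sub.
case/shortenP: up lp => q uq uniq_q qp lq.
have qr : (size q < r.+1)%N.
  by rewrite ltnS; apply: leq_trans pr; apply: uniq_leq_size => //; case/andP: uniq_q.
apply/bigcupP; exists (Ordinal qr) => //; rewrite inE; apply/asboolP; exists q.
by split=> //; apply: (not_heavy_prod (s := s)) => //; rewrite lq; apply: SX.
Qed.

Lemma good_splitting b s D kappa Delta G K :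
  0 < b -> b < s -> s <= D -> s ^+ 2 <= b * (D - 1) ->
  (1 < K)%N -> kappa <= (s - b) / 22 ->
  no_bicycle G (5 * K) -> sparse_excess G K b kappa ->
  (forall u r, (1 <= r)%N -> #|gball G u r|%:R <= D ^+ (r - 1) * Delta) ->
  exists G1 G2 : graph V,
    [/\ G = G1 :|: G2, [disjoint G1 & G2], (max_degree G1)%:R <= D, near_forest G2 &
      (forall u r, (1 <= r)%N -> #|gball G2 u r|%:R <= D ^+ (r - 1) * Delta) /\
      (forall u r, #|(non_isolated G1 :&: non_isolated G2) :&: gball G2 u r|%:R <= D ^+ r)].
Proof.
move=> b0 bs sD sD2 K1 ks nb E2 ball.
have s0 : 0 < s by apply: lt_trans bs.
have D1 : 1 <= D.
  by rewrite -subr_ge0 -(pmulr_rge0 _ b0); apply: le_trans sD2; rewrite exprn_ge0 // ltW.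
set X := heavy_set b s G.
have G2G : touching X G \subset G by apply/subsetP => e; rewrite inE => /andP[].
(* An edge of [G1] misses [X], so its endpoints lie in no heavy set. *)
have XG1 y : y \in non_isolated (G :\: touching X G) -> ~ heavy b s G y.
  rewrite inE => /existsP[v /adj_edge[e + ve]]; rewrite !inE => /andP[+ eG].
  rewrite eG negbK => /pred0P/(_ y); rewrite /= ve !inE eqxx /= => yX hy.
  by move: yX; rewrite asboolT.
exists (G :\: touching X G), (touching X G); split.
- by apply/setP => e; rewrite !inE; case: (e \in G); rewrite ?orbF //= andbT orNb.
- apply/pred0P => e; rewrite /= !inE.
  by case: (e \in G); case: [disjoint _ & _].
- apply: (big_ind (fun m : nat => m%:R <= D)) => [|m n|v _]; first by apply: le_trans D1.
    by move=> mD nD; rewrite /maxn; case: ifP.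
  have [d0|[w vw]] := set_0Vmem [set w | adj (G :\: touching X G) v w].
    by rewrite /degree d0 cards0; apply: le_trans D1.
  have vX : ~ heavy b s G v.
    by apply: XG1; rewrite inE; apply/existsP; exists w; rewrite inE in vw.
  have dG : (degree (G :\: touching X G) v <= degree G v)%N.
    by apply/subset_leq_card/subsetP => z; rewrite !inE; apply: adj_sub; apply: subsetDl.
  apply: (@le_trans _ _ (degree G v)%:R); first by rewrite ler_nat.
  rewrite leNgt; apply/negP => Dv; apply: vX; exists [set v]; split.
  + by rewrite inE.
  + by move=> x y; rewrite !inE => /eqP-> /eqP->.
  by rewrite big_set1 cards1 mulr1 lt_max (le_lt_trans sD Dv).
- apply: (near_forest_of_short_paths (K := K) G2G).
    move=> W e f Wle; apply: nb; apply: leq_trans Wle _; clear; lia.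
  by move=> x p; apply: no_long_path E2 nb.
split=> [u r r1|u r].
  by apply: le_trans (ball u r r1); rewrite ler_nat subset_leq_card // gball_sub.
apply: le_trans (sum_powers_le r D1).
apply: (@le_trans _ _ (\sum_(j < r.+1) #|reach_le b G ((D - 1) ^+ j) u j|%:R)).
  rewrite -natr_sum ler_nat; apply: leq_trans (leq_card_bigcup _ _).
  apply: subset_leq_card; apply: (gball_reach u r b0 (ltW bs) sD2 G2G).
  by move=> y /setIP[/XG1].
apply: ler_sum => j _; apply: card_reach_le => //.
by rewrite exprn_ge0 // subr_ge0.
Qed.

End Splitting.

(** * Exponential moments and union bounds over trees *)

Section EdgeCounting.
Variable T : finType.
Implicit Types (G : graph T) (A : {set T}) (u v : T).

(** An edge at [u] is determined by its other endpoint. The predicate [P] lets this serve both for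
    sums over all pairs and for degrees in a graph. *)
Lemma edges_at_imset (P : pred {set T}) u :
  val @: [set e : edge T | (u \in val e) && P (val e)] =
  [set [set u; v] | v in [set v | (v != u) && P [set u; v]]].
Proof.
apply/setP => s; apply/imsetP/imsetP => [[e + ->]|[v + ->]].
  rewrite inE; have [x [y [xy ->]]] := edgeP e; rewrite !inE.
  case/andP=> /orP[]/eqP-> Pe.
    by exists y; rewrite // inE eq_sym xy.
  by exists x; rewrite ?inE ?xy ?[_ |: [set y]]setUC //= setUC.
rewrite inE => /andP[vu Pv].
have card2 : #|[set u; v]| == 2%N by rewrite cards2 (eq_sym u) vu.
by exists (exist _ [set u; v] card2); rewrite // inE /= !inE eqxx.
Qed.

Lemma set2_injr u : injective (fun v => [set u; v]).
Proof. by move=> v w; apply: set2_eq. Qed.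

Lemma sum_edges_at (R : nmodType) u (F : {set T} -> R) :
  \sum_(e : edge T | u \in val e) F (val e) = \sum_(v | v != u) F [set u; v].
Proof.
have := edges_at_imset xpredT u.
move/(congr1 (fun X : {set {set T}} => \sum_(s in X) F s)).
rewrite big_imset /=; last by move=> e f _ _; apply: val_inj.
rewrite big_imset /=; last by move=> v w _ _; apply: set2_injr.
under eq_bigl do rewrite inE andbT.
by under [X in _ = X -> _]eq_bigl do rewrite inE andbT.
Qed.

Lemma degree_edges G u : degree G u = #|[set e in G | u \in val e]|.
Proof.
pose P (s : {set T}) := [exists e in G, val e == s].
have := congr1 (fun X : {set {set T}} => #|X|) (edges_at_imset P u).
rewrite card_imset; last exact: val_inj.
rewrite card_imset; last exact: set2_injr.
have -> : [set e in G | u \in val e] = [set e : edge T | (u \in val e) && P (val e)].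
  apply/setP => e; rewrite !inE andbC; congr (_ && _).
  apply/idP/existsP => [eG|[f /andP[fG /eqP/val_inj<-]]//].
  by exists e; rewrite eG /=.
move=> ->; apply: eq_card => v; rewrite !inE -[adj G u v]/(P [set u; v]).
have [->|//] := eqVneq v u.
by rewrite -[P [set u; u]]/(adj G u u) adj_irr.
Qed.

Lemma sum_degree G A : (\sum_(u in A) degree G u = \sum_(e in G) #|val e :&: A|)%N.
Proof.
transitivity (\sum_(u in A) \sum_(e in G) (u \in val e))%N.
  apply: eq_bigr => u _; rewrite degree_edges -sum1_card big_mkcond /= [RHS]big_mkcond /=.
  by apply: eq_bigr => e _; rewrite inE; case: (e \in G); case: (u \in _).
rewrite exchange_big /=; apply: eq_bigr => e _; rewrite -sum1_card -big_mkcondr.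
by apply: eq_bigl => u; rewrite inE andbC.
Qed.

End EdgeCounting.

(** * Random subsets with independent elements *)

Section BernoulliSubsets.
Variables (R : realType) (E : finType).
Implicit Types (p x : E -> R) (F G : {set E}) (Z : {set E} -> Prop).

Definition bernoulli_mass p G : R := \prod_e (if e \in G then p e else 1 - p e).

Definition bernoulli_pr p Z : R := \sum_(G | `[< Z G >]) bernoulli_mass p G.

(** By independence the mean of a product weight on the event [F \subset G] factors over the
    elements. In the expansion, [b] vanishes on [F] and thereby removes the sets that miss an
    element of [F]. *)
Lemma bernoulli_transform p x F :
  \sum_(G : {set E}) (F \subset G)%:R * bernoulli_mass p G * \prod_(e in G) x e =
  \prod_e (if e \in F then p e * x e else 1 + p e * (x e - 1)).
Proof.
pose b e := if e \in F then 0 else 1 - p e.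
transitivity (\prod_e (p e * x e + b e)); last first.
  by apply: eq_bigr => e _; rewrite /b; case: ifP => _; ring.
rewrite (bigA_distr _ _ (fun e => p e * x e) b); apply: eq_bigr => G _.
have -> : (F \subset G)%:R = \prod_e (if (e \in F) && (e \notin G) then 0 else 1) :> R.
  have [FG|/subsetPn[e eF eG]] := boolP (F \subset G).
    by rewrite big1 // => e _; case: ifP => // /andP[/(subsetP FG)->].
  by rewrite (bigD1 e) //= eF eG mul0r.
rewrite [X in _ * X]big_mkcond /bernoulli_mass -!big_split /=.
apply: eq_bigr => e _; rewrite /b.
by case: (e \in G); case: (e \in F) => /=; rewrite ?mul1r ?mulr1 ?mul0r.
Qed.

Lemma bernoulli_mass_ge0 p G : (forall e, 0 <= p e <= 1) -> 0 <= bernoulli_mass p G.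
Proof.
by move=> p01; apply: prodr_ge0 => e _; have /andP[] := p01 e; case: ifP; rewrite ?subr_ge0.
Qed.

Section Bounds.
Variable p : E -> R.
Hypothesis p01 : forall e, 0 <= p e <= 1.

Let mass_ge0 G := bernoulli_mass_ge0 G p01.

Lemma bernoulli_prE Z : bernoulli_pr p Z = \sum_G `[< Z G >]%:R * bernoulli_mass p G.
Proof.
rewrite /bernoulli_pr big_mkcond; apply: eq_bigr => G _.
by case: asboolP; rewrite ?mul1r ?mul0r.
Qed.

Lemma bernoulli_pr0 Z : (forall G, ~ Z G) -> bernoulli_pr p Z = 0.
Proof. by move=> nZ; rewrite bernoulli_prE big1 // => G _; rewrite asboolF ?mul0r. Qed.

Lemma bernoulli_pr_ge0 Z : 0 <= bernoulli_pr p Z.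
Proof. exact: sumr_ge0. Qed.

Lemma le_bernoulli_pr Z Z' : (forall G, Z G -> Z' G) ->
  bernoulli_pr p Z <= bernoulli_pr p Z'.
Proof.
move=> ZZ'; rewrite !bernoulli_prE; apply: ler_sum => G _; apply: ler_wpM2r => //.
by case: asboolP => // /ZZ' h; rewrite asboolT.
Qed.

Lemma bernoulli_pr_exists (I : finType) (P : pred I) (Z : I -> {set E} -> Prop) (c : R) :
  (forall i, P i -> bernoulli_pr p (Z i) <= c) ->
  bernoulli_pr p (fun G => exists2 i, P i & Z i G) <= #|P|%:R * c.
Proof.
move=> Zc; apply: (@le_trans _ _ (\sum_(i | P i) bernoulli_pr p (Z i))); last first.
  by apply: le_trans (ler_sum _ Zc) _; rewrite sumr_const mulr_natl.
under [leRHS]eq_bigr do rewrite bernoulli_prE.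
rewrite bernoulli_prE exchange_big /=; apply: ler_sum => G _.
rewrite -mulr_suml; apply: ler_wpM2r => //.
case: asboolP => [[i Pi ZiG]|_]; last by apply: sumr_ge0.
by rewrite (bigD1 i) //= asboolT // lerDl sumr_ge0.
Qed.

Lemma bernoulli_pr_or Z Z' :
  bernoulli_pr p (fun G => Z G \/ Z' G) <= bernoulli_pr p Z + bernoulli_pr p Z'.
Proof.
rewrite !bernoulli_prE -big_split /=; apply: ler_sum => G _.
rewrite -mulrDl; apply: ler_wpM2r => //.
case: asboolP => [|_]; last by rewrite addr_ge0.
by case=> h; rewrite (asboolT h) ?lerDl ?lerDr.
Qed.

Lemma bernoulli_markov (F : {set E}) x (Z : {set E} -> Prop) (c : R) :
  0 < c -> (forall e, 0 <= x e) ->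
  (forall G, Z G -> F \subset G /\ c <= \prod_(e in G) x e) ->
  bernoulli_pr p Z <= \prod_e (if e \in F then p e * x e else 1 + p e * (x e - 1)) / c.
Proof.
move=> c0 x0 Zc; rewrite -bernoulli_transform ler_pdivlMr // bernoulli_prE mulr_suml.
apply: ler_sum => G _; rewrite mulrAC [leRHS]mulrAC; apply: ler_wpM2r => //.
have pr0 : 0 <= \prod_(e in G) x e by apply: prodr_ge0.
case: asboolP => [/Zc[-> le]|_]; first by rewrite !mul1r.
by rewrite mul0r mulr_ge0.
Qed.

End Bounds.
End BernoulliSubsets.

Lemma expR_ge1_nneg (R : realType) (x : R) : 0 <= x -> 1 <= expR x.
Proof. by move=> x0; rewrite -expR0 ler_expR. Qed.

(** * First moment over spanning trees *)

Section TreeUnionBound.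
Variables (R : realType) (T : finType) (p : edge T -> R) (q dd : R).
Hypothesis p01 : forall e, 0 <= p e <= 1.
Hypothesis q0 : 0 <= q.
Hypothesis pq : forall e, p e <= q.
Hypothesis p_deg : forall u : T, \sum_(e : edge T | u \in val e) p e <= dd.
Implicit Types (F G : graph T) (A W : {set T}) (theta s t b : R) (k : nat).

Let tilt theta A (e : edge T) : R := expR (theta * #|val e :&: A|%:R).

Lemma prod_tilt theta A G :
  \prod_(e in G) tilt theta A e = expR (theta * (\sum_(u in A) degree G u)%:R).
Proof. by rewrite sum_degree natr_sum mulr_sumr expR_sum. Qed.

Lemma card_edgeI (e : edge T) A : (#|val e :&: A| <= 2)%N.
Proof.
by apply: leq_trans (subset_leq_card (subsetIl _ _)) _; rewrite (eqP (valP e)).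
Qed.

Lemma tilt_le theta A e : 0 <= theta -> tilt theta A e <= expR (2 * theta).
Proof.
by move=> t0; rewrite ler_expR mulrC ler_wpM2r // ler_nat card_edgeI.
Qed.

Lemma tilt_ge1 theta A e : 0 <= theta -> 1 <= tilt theta A e.
Proof. by move=> t0; apply/expR_ge1_nneg/mulr_ge0. Qed.

(** Convexity in the number of endpoints in [A], with equality at 0 and 2; the case 1 amounts to
    [(expR theta - 1) ^+ 2 >= 0]. *)
Lemma tilt_linear theta A e :
  tilt theta A e - 1 <= #|val e :&: A|%:R * ((expR (2 * theta) - 1) / 2).
Proof.
rewrite /tilt [2 * theta]mulr_natl mulr2n expRD.
have := card_edgeI e A; case: #|_| => [|[|[|//]]] _.
- by rewrite mulr0 expR0 mul0r subrr.
- by rewrite mulr1 mul1r; have := sqr_ge0 (expR theta - 1); rewrite expr2; nra.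
by rewrite mulr_natr mulr2n expRD; lra.
Qed.

(* An edge inside A is counted twice in the degree sum; tilt_linear charges half of
   e^(2 theta) - 1 to each endpoint in A. *)
Lemma tilted_transform_le theta A F : 0 <= theta ->
  \prod_e (if e \in F then p e * tilt theta A e else 1 + p e * (tilt theta A e - 1)) <=
  (q * expR (2 * theta)) ^+ #|F| *
  expR (#|A|%:R * (dd * ((expR (2 * theta) - 1) / 2))).
Proof.
move=> t0; set c := q * _; set B : R := (_ - 1) / 2.
have p0 e : 0 <= p e by case/andP: (p01 e).
have B0 : 0 <= B by rewrite divr_ge0 // subr_ge0 expR_ge1_nneg // mulr_ge0.
have d0 e : 0 <= p e * (tilt theta A e - 1) by rewrite mulr_ge0 // subr_ge0 tilt_ge1.
apply: (@le_trans _ _ (\prod_e ((if e \in F then c else 1) *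
    expR (p e * (tilt theta A e - 1))))).
  apply: ler_prod => e _; case: ifP => _; apply/andP; split.
  - by rewrite mulr_ge0 // ltW // expR_gt0.
  - rewrite -[leLHS]mulr1; apply: ler_pM => //.
    + by rewrite mulr_ge0 // ltW // expR_gt0.
    + apply: ler_pM => //; [by rewrite ltW // expR_gt0 | exact: tilt_le].
    exact: expR_ge1_nneg.
  - by rewrite addr_ge0.
  by rewrite mul1r expR_ge1Dx.
rewrite big_split /= -big_mkcond prodr_const; apply: ler_wpM2l.
  by rewrite exprn_ge0 // mulr_ge0 ?expR_ge0.
rewrite -expR_sum ler_expR.
apply: (@le_trans _ _ (\sum_(e : edge T) \sum_(u in A) (if u \in val e then p e * B else 0) : R)).
  apply: ler_sum => e _; apply: le_trans (ler_wpM2l (p0 e) (tilt_linear _ _ _)) _.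
  rewrite -big_mkcondr sumr_const -/B mulrCA mulr_natl.
  rewrite (_ : #|val e :&: A| = #|[pred u in A | u \in val e]|) //.
  by apply: eq_card => u; rewrite !inE andbC.
rewrite exchange_big /= mulr_natl -sumr_const; apply: ler_sum => u _.
by rewrite -big_mkcond -mulr_suml ler_wpM2r.
Qed.
(** Markov's inequality for the tilted weight. The exponent per vertex of [A] is at most [b], and
    [0 <= b] allows replacing [#|A|] by [k]. *)
Lemma fixed_tree_excess_pr F A theta s t b k : 0 <= theta ->
  dd * ((expR (2 * theta) - 1) / 2) - theta * s <= b -> 0 <= b -> (#|A| <= k)%N ->
  bernoulli_pr p (fun G => F \subset G /\ s * #|A|%:R + t <= (\sum_(u in A) degree G u)%:R) <=
  (q * expR (2 * theta)) ^+ #|F| * expR (k%:R * b - theta * t).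
Proof.
move=> t0 sb b0 Ak.
apply: le_trans (bernoulli_markov p01 (x := tilt theta A) (F := F)
  (c := expR (theta * (s * #|A|%:R + t))) _ _ _) _.
- exact: expR_gt0.
- by move=> e; apply: expR_ge0.
- by move=> G [-> le]; split=> //; rewrite prod_tilt ler_expR ler_wpM2l.
apply: (@le_trans _ _ ((q * expR (2 * theta)) ^+ #|F| *
  expR (#|A|%:R * (dd * ((expR (2 * theta) - 1) / 2))) / expR (theta * (s * #|A|%:R + t)))).
  by rewrite ler_wpM2r ?invr_ge0 ?expR_ge0 //; apply: tilted_transform_le.
rewrite -mulrA -expRN -expRD; apply: ler_wpM2l.
  by rewrite exprn_ge0 // mulr_ge0 ?expR_ge0.
rewrite ler_expR.
apply: (@le_trans _ _ (#|A|%:R * b - theta * t)); last first.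
  by rewrite lerD2r ler_wpM2r // ler_nat.
rewrite [leLHS](_ : _ =
  #|A|%:R * (dd * ((expR (2 * theta) - 1) / 2) - theta * s) - theta * t); last by ring.
by rewrite lerD2r ler_wpM2l.
Qed.

Lemma connected_tree_edges G W k : connected_set G W -> #|W| = k -> (0 < k)%N ->
  exists2 r, r \in W & exists2 f : {ffun T -> T}, f \in pffun_on r W W &
    tree_edges W r f \subset G /\ #|tree_edges W r f| = k.-1.
Proof.
move=> cW Wk k0; have /card_gt0P[r rW] : (0 < #|W|)%N by rewrite Wk.
have [f [fW fG fI]] := spanning_tree rW cW.
exists r => //; exists f => //; split; first exact: tree_edges_sub fG.
by rewrite (card_tree_edges rW fG fI) Wk.
Qed.

(* Trees on W are counted by their parent functions: the crude k^k is affordable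
   because 'C(n, k) contributes 1 / k!. *)
Lemma rooted_trees_pr k (Z : {set T} -> T -> {ffun T -> T} -> graph T -> Prop) (c : R) :
  (forall W r f, #|W| = k -> bernoulli_pr p (Z W r f) <= c) ->
  bernoulli_pr p (fun G => exists2 W : {set T}, #|W| == k & exists2 r, r \in W &
    exists2 f : {ffun T -> T}, f \in pffun_on r W W & Z W r f G) <=
  ('C(#|T|, k))%:R * (k%:R * ((k ^ k)%:R * c)).
Proof.
move=> Zc; rewrite -card_draws cardsE.
apply: (bernoulli_pr_exists p01 (P := fun W : {set T} => #|W| == k)) => W /eqP Wk.
rewrite -{1}Wk.
apply: (bernoulli_pr_exists p01 (P := [in W])) => r rW.
rewrite -[in (k ^ k)%N]Wk -(card_pffun_on r).
apply: (bernoulli_pr_exists p01 (P := [in pffun_on r W W])) => f _.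
exact: Zc.
Qed.

Lemma connected_excess_pr k theta s t b : (0 < k)%N -> 0 <= theta ->
  dd * ((expR (2 * theta) - 1) / 2) - theta * s <= b -> 0 <= b ->
  bernoulli_pr p (fun G => exists (W A : {set T}), [/\ connected_set G W, #|W| = k, A \subset W &
    s * #|A|%:R + t <= (\sum_(u in A) degree G u)%:R]) <=
  ('C(#|T|, k))%:R * (k%:R * ((k ^ k)%:R * ((2 ^ k)%:R *
    ((q * expR (2 * theta)) ^+ k.-1 * expR (k%:R * b - theta * t))))).
Proof.
move=> k0 t0 sb b0.
(* The number of edges is part of the event, so parent functions whose edge set has the wrong size
   contribute 0. *)
pose Z W r (f : {ffun T -> T}) G := exists2 A, A \in powerset W &
  #|tree_edges W r f| = k.-1 /\
  (tree_edges W r f \subset G /\ s * #|A|%:R + t <= (\sum_(u in A) degree G u)%:R).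
apply: (@le_trans _ _ (bernoulli_pr p (fun G => exists2 W : {set T}, #|W| == k & exists2 r, r \in W &
    exists2 f : {ffun T -> T}, f \in pffun_on r W W & Z W r f G))).
  apply: le_bernoulli_pr => // G [W [A [cW Wk AW le]]]; exists W; first exact/eqP.
  have [r rW [f fW [fG fk]]] := connected_tree_edges cW Wk k0.
  by exists r => //; exists f => //; exists A; rewrite ?inE.
apply: rooted_trees_pr => W r f Wk.
rewrite -[in (2 ^ k)%N]Wk -card_powerset.
apply: (bernoulli_pr_exists p01 (P := [in powerset W])) => A; rewrite inE => AW.
have [<-|Fk] := eqVneq #|tree_edges W r f| k.-1; last first.
  rewrite bernoulli_pr0; last by move=> G [/eqP]; rewrite (negPf Fk).
  by rewrite mulr_ge0 ?expR_ge0 // exprn_ge0 // mulr_ge0 ?expR_ge0.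
have Ak : (#|A| <= k)%N by rewrite -Wk subset_leq_card.
apply: le_trans (fixed_tree_excess_pr (tree_edges W r f) t t0 sb b0 Ak).
by apply: le_bernoulli_pr => // G [_].
Qed.

Lemma card_edges_in W : (#|[pred e : edge T | val e \subset W]| <= #|W| ^ 2)%N.
Proof.
have -> : #|[pred e : edge T | val e \subset W]| = 'C(#|W|, 2).
  rewrite -cards_draws -(card_imset _ val_inj); apply: eq_card => s.
  apply/imsetP/idP => [[e + ->]|]; first by rewrite !inE (valP e) andbT.
  by rewrite !inE => /andP[sW s2]; exists (exist _ s s2); rewrite // inE.
rewrite bin2 -mulnn; apply: leq_trans (leq_mul (leqnn _) (leq_pred _)).
by rewrite -divn2 leq_div.
Qed.

Lemma subset_pr F : bernoulli_pr p (fun G => F \subset G) <= q ^+ #|F|.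
Proof.
have B0 : dd * ((expR (2 * 0) - 1) / 2) - 0 * 0 <= 0 :> R.
  by rewrite mulr0 expR0 subrr mul0r mulr0 mul0r subr0.
have := @fixed_tree_excess_pr F set0 0 0 0 0 0 (lexx 0) B0 (lexx 0) (eq_leq (cards0 _)).
rewrite !mulr0 !mul0r subrr expR0 !mulr1; apply: le_trans.
by apply: le_bernoulli_pr => // G FG; rewrite ?mul0r addr0 big_set0.
Qed.

(** A spanning tree of [W] avoiding [e] and [f] has [k - 1] edges, so [k + 1] edges are prescribed
    on [k] vertices, which will leave a factor of order [1 / n]. *)
Lemma bicycle_pr k : (0 < k)%N ->
  bernoulli_pr p (fun G => exists W : {set T}, #|W| = k /\ exists e f : edge T,
    [/\ e \in G, f \in G, e != f, val e \subset W & val f \subset W] /\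
    connected_set (G :\ e :\ f) W) <=
  ('C(#|T|, k))%:R * (k%:R * ((k ^ k)%:R * ((k ^ 2)%:R * ((k ^ 2)%:R * q ^+ k.+1)))).
Proof.
move=> k0.
pose Z W r (h : {ffun T -> T}) G :=
  exists2 e, e \in [pred e : edge T | val e \subset W] &
  exists2 f, f \in [pred e : edge T | val e \subset W] &
    #|e |: (f |: tree_edges W r h)| = k.+1 /\ e |: (f |: tree_edges W r h) \subset G.
apply: (@le_trans _ _ (bernoulli_pr p (fun G => exists2 W : {set T}, #|W| == k &
    exists2 r, r \in W & exists2 h : {ffun T -> T}, h \in pffun_on r W W & Z W r h G))).
  apply: le_bernoulli_pr => // G [W [Wk [e [f [[eG fG ef eW fW] cW]]]]].
  exists W; first exact/eqP.
  have [r rW [h hW [hG hk]]] := connected_tree_edges cW Wk k0.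
  exists r => //; exists h => //; exists e => //; exists f => //; split.
    have eF : e \notin f |: tree_edges W r h.
      rewrite in_setU1 negb_or ef /=; apply/negP => /(subsetP hG).
      by rewrite !inE eqxx andbF.
    have fF : f \notin tree_edges W r h.
      by apply/negP => /(subsetP hG); rewrite !inE eqxx.
    by rewrite !cardsU1 eF fF hk; move: k0; clear; lia.
  rewrite !subUset !sub1set eG fG /=; apply: subset_trans hG _.
  by apply/(subset_trans (subsetDl _ _))/subsetDl.
apply: rooted_trees_pr => W r h Wk.
have q1 : 0 <= q ^+ k.+1 by apply: exprn_ge0.
have Wk2 : #|[pred e : edge T | val e \subset W]|%:R <= (k ^ 2)%:R :> R.
  by rewrite ler_nat -Wk card_edges_in.
apply: le_trans (bernoulli_pr_exists p01 (c := (k ^ 2)%:R * q ^+ k.+1) _) _; last first.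
  by apply: ler_wpM2r => //; apply: mulr_ge0.
move=> e _.
apply: le_trans (bernoulli_pr_exists p01 (c := q ^+ k.+1) _) _; last by apply: ler_wpM2r.
move=> f _; set F := e |: _.
have [<-|Fk] := eqVneq #|F| k.+1; last first.
  by rewrite bernoulli_pr0 // => G [/eqP]; rewrite (negPf Fk).
by apply: le_trans (subset_pr F); apply: le_bernoulli_pr => // G [].
Qed.

End TreeUnionBound.

(** * Numerical estimates for the union bounds *)

Section CountingBounds.
Variable R : realType.
Implicit Types (k n : nat) (d theta b t : R).

Lemma ffact_le_expn n k : (n ^_ k <= n ^ k)%N.
Proof.
elim: k => [|k IH]; first by rewrite ffactn0.
by rewrite ffactnSr expnSr leq_mul // leq_subr.
Qed.

(** The quotient of [k ^ k] by the factorial of [k] is a term of the exponential series at [k]. *)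
Lemma expn_self_le k : (k ^ k)%:R <= expR k%:R * k`!%:R :> R.
Proof.
case: k => [|k]; first by rewrite expn0 fact0 expR0 mulr1.
rewrite -ler_pdivrMr ?ltr0n ?fact_gt0 // natrX.
by apply: le_trans (expR_ge1Dxn k (ler0n R k.+1)); rewrite lerDr.
Qed.

Lemma bin_expn_le n k : 'C(n, k)%:R * (k ^ k)%:R <= (n%:R * expR 1) ^+ k :> R.
Proof.
rewrite exprMn -expRM_natl mulr1.
apply: le_trans (ler_wpM2l (ler0n _ _) (expn_self_le k)) _.
rewrite mulrCA mulrC; apply: ler_wpM2r; first exact: expR_ge0.
by rewrite -natrM bin_ffact -natrX ler_nat ffact_le_expn.
Qed.

Lemma two_le_expR1 : 2 <= expR 1 :> R.
Proof. by apply: le_trans (expR_ge1Dx 1); rewrite -[2]/(1 + 1). Qed.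

Lemma pow2_le_expR k : 2 ^+ k <= expR k%:R :> R.
Proof.
rewrite -[k%:R]mulr1 expRM_natl; apply: lerXn2r; rewrite ?nnegrE ?expR_ge0 //.
exact: two_le_expR1.
Qed.

Lemma nat_le_pow2 k : k%:R <= 2 ^+ k :> R.
Proof. by rewrite -natrX ler_nat ltnW // ltn_expl. Qed.

(** Since [n%:R * Q >= 1], a further factor [Q] may be inserted at the price of [n]. Then everything
    is a [k]-th power with base [8 * expR 1 * d * expR (2 * theta)], and [8 <= expR 3]. *)
Lemma tree_count_le n k d theta b t : (0 < n)%N -> (0 < k)%N -> 1 <= d -> 0 <= theta ->
  'C(n, k)%:R * (k%:R * ((k ^ k)%:R * ((2 ^ k)%:R *
    ((2 * d / n%:R * expR (2 * theta)) ^+ k.-1 * expR (k%:R * b - theta * t))))) <=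
  n%:R * expR (k%:R * (4 + ln d + 2 * theta + b) - theta * t).
Proof.
move=> n0 k0 d1 t0.
have nR : 0 < n%:R :> R by rewrite ltr0n.
have nR0 := ltW nR.
have d0 : 0 < d by lra.
have e1 : 1 <= expR (2 * theta) by apply/expR_ge1_nneg/mulr_ge0.
set Q := 2 * d / n%:R * expR (2 * theta).
have Q0 : 0 <= Q by rewrite !mulr_ge0 ?invr_ge0 ?expR_ge0 //; lra.
have Qk : Q ^+ k.-1 <= n%:R * Q ^+ k.
  rewrite -{2}(prednK k0) exprS mulrA -[leLHS]mul1r; apply: ler_wpM2r.
    exact: exprn_ge0.
  rewrite /Q mulrA mulrCA mulfV ?gt_eqF // mulr1.
  by clear Q Q0; move: e1; set e := expR _ => e1; nra.
have -> : k%:R * (4 + ln d + 2 * theta + b) - theta * t =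
    k%:R * (4 + ln d + 2 * theta) + (k%:R * b - theta * t) by ring.
move: (_ - theta * t) => X; rewrite expRD !mulrA; apply: ler_wpM2r; first exact: expR_ge0.
apply: le_trans (ler_wpM2l _ Qk) _; first by rewrite !mulr_ge0.
rewrite [(2 ^ k)%:R]natrX.
rewrite [leLHS](_ : _ = n%:R * ('C(n, k)%:R * (k ^ k)%:R * (k%:R * (2 ^+ k * Q ^+ k)))); last by ring.
apply: ler_wpM2l => //.
apply: (@le_trans _ _ ((n%:R * expR 1) ^+ k * (2 ^+ k * (2 ^+ k * Q ^+ k)))).
  apply: ler_pM; rewrite ?mulr_ge0 ?exprn_ge0 //; first exact: bin_expn_le.
  apply: ler_wpM2r; last exact: nat_le_pow2.
  by rewrite mulr_ge0 // exprn_ge0.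
rewrite -!exprMn expRM_natl.
apply: lerXn2r; rewrite ?nnegrE ?expR_ge0 //; first exact: mulr_ge0 (mulr_ge0 nR0 (expR_ge0 1)) (mulr_ge0 (ler0n _ 2) (mulr_ge0 (ler0n _ 2) Q0)).
rewrite [leLHS](_ : _ = 2 ^+ 3 * (expR 1 * (d * expR (2 * theta)))); last first.
  by rewrite /Q; field; apply: lt0r_neq0.
have -> : expR (4 + ln d + 2 * theta) = expR 3 * (expR 1 * (d * expR (2 * theta))).
  by rewrite -[X in _ * (_ * (X * _))](lnK (x := d)) ?posrE // -!expRD; congr expR; ring.
apply: ler_wpM2r; last exact: pow2_le_expR.
by rewrite !mulr_ge0 ?expR_ge0 //; lra.
Qed.

(** One factor [2 * d / n%:R] stays outside. The polynomial factor is bounded by [(2 ^+ k) ^+ 5], so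
    the base of the rest is [2 ^+ 6 * expR 1 * d]. *)
Lemma bicycle_count_le n k d : (0 < n)%N -> 1 <= d ->
  'C(n, k)%:R * (k%:R * ((k ^ k)%:R * ((k ^ 2)%:R * ((k ^ 2)%:R * (2 * d / n%:R) ^+ k.+1)))) <=
  2 * d / n%:R * expR (k%:R * (7 + ln d)).
Proof.
move=> n0 d1.
have nR : 0 < n%:R :> R by rewrite ltr0n.
have nR0 := ltW nR.
have d0 : 0 < d by lra.
set Q := 2 * d / n%:R.
have Q0 : 0 <= Q by rewrite !mulr_ge0 ?invr_ge0 //; lra.
rewrite exprS !natrX.
rewrite [leLHS](_ : _ = Q * ('C(n, k)%:R * k%:R ^+ k * (k%:R ^+ 5 * Q ^+ k))); last by ring.
apply: ler_wpM2l => //.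
apply: (@le_trans _ _ ((n%:R * expR 1) ^+ k * ((2 ^+ k) ^+ 5 * Q ^+ k))).
  apply: ler_pM; rewrite ?mulr_ge0 ?exprn_ge0 //; first by rewrite -natrX bin_expn_le.
  apply: ler_wpM2r; first exact: exprn_ge0.
  by apply: lerXn2r; rewrite ?nnegrE ?exprn_ge0 // nat_le_pow2.
rewrite exprAC -!exprMn expRM_natl.
apply: lerXn2r; rewrite ?nnegrE ?expR_ge0 //; first exact: mulr_ge0 (mulr_ge0 nR0 (expR_ge0 1)) (mulr_ge0 (exprn_ge0 5 (ler0n _ 2)) Q0).
rewrite [leLHS](_ : _ = 2 ^+ 6 * (expR 1 * d)); last first.
  by rewrite /Q; field; apply: lt0r_neq0.
have -> : expR (7 + ln d) = expR 6 * (expR 1 * d).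
  by rewrite -[X in _ * (_ * X)](lnK (x := d)) ?posrE // -!expRD; congr expR; ring.
apply: ler_wpM2r; last exact: pow2_le_expR.
by rewrite !mulr_ge0 ?expR_ge0 //; lra.
Qed.

End CountingBounds.

(** * The stochastic block model *)

Section Labels.
Variables (R : realType) (n : nat).
Implicit Types (s : labelling n) (i j u v : 'I_n) (d lambda : R).

Definition spin s i : R := if s i then 1 else -1.

Definition imbalance s : R := `|\sum_i spin s i|.

Lemma spin_sqr s i : spin s i * spin s i = 1.
Proof. by rewrite /spin; case: ifP; rewrite ?mulr1 ?mulrNN ?mulr1. Qed.

Lemma norm_spin s i : `|spin s i| = 1.
Proof. by rewrite /spin; case: ifP; rewrite ?normrN normr1. Qed.

Lemma edge_prob_pair d lambda s (e : edge 'I_n) u v : val e = [set u; v] ->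
  edge_prob d lambda s e = (d + lambda * Num.sqrt d * (spin s u * spin s v)) / n%:R.
Proof.
move=> ve; rewrite /edge_prob (_ : monochromatic s e = (s u == s v)).
  by rewrite /spin; case: (s u); case: (s v) => /=; congr (_ / _); ring.
rewrite /monochromatic ve; apply/forall_inP/eqP => [h|E x].
  have /h/forall_inP : u \in [set u; v] by rewrite !inE eqxx.
  by move=> /(_ v) h'; apply/eqP/h'; rewrite !inE eqxx orbT.
by rewrite !inE => /orP[]/eqP->; apply/forall_inP => y; rewrite !inE => /orP[]/eqP->;
  rewrite ?E eqxx.
Qed.

(** Besides the average [d], a label term remains: [lambda * Num.sqrt d], at most [d] in absolute
    value, times the sum of the spins other than that of [u], which is at most [imbalance s + 1]. *)
Lemma sum_edge_prob d lambda s u : 0 <= d -> `|lambda| <= Num.sqrt d ->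
  \sum_(e : edge 'I_n | u \in val e) edge_prob d lambda s e <=
  d * (1 + (imbalance s + 1) / n%:R).
Proof.
move=> d0 ld.
have n0 : 0 < n%:R :> R by rewrite ltr0n; case: u => m; case: (n).
have ldd : `|lambda * Num.sqrt d| <= d.
  rewrite normrM (ger0_norm (sqrtr_ge0 _)) -[leRHS](sqr_sqrtr d0) expr2.
  by rewrite ler_wpM2r // sqrtr_ge0.
pose F (X : {set 'I_n}) : R := (if [forall u in X, forall v in X, s u == s v]
  then d + lambda * Num.sqrt d else d - lambda * Num.sqrt d) / n%:R.
rewrite (eq_bigr (fun e : edge 'I_n => F (val e))) // sum_edges_at.
have FE v : v != u -> F [set u; v] =
    (d + lambda * Num.sqrt d * (spin s u * spin s v)) / n%:R.
  move=> vu; have c2 : #|[set u; v]| == 2 by rewrite cards2 (eq_sym u) vu.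
  exact: (edge_prob_pair d lambda s (e := exist _ [set u; v] c2) (erefl _)).
rewrite (eq_bigr _ FE) -mulr_suml ler_pdivrMr // big_split /= sumr_const.
rewrite -mulr_sumr -mulr_sumr.
have -> : \sum_(v | v != u) spin s v = \sum_v spin s v - spin s u.
  by rewrite [X in _ = X - _](bigD1 u) //= addrC addrK.
have -> : d * (1 + (imbalance s + 1) / n%:R) * n%:R = d * n%:R + d * (imbalance s + 1).
  by field; apply: lt0r_neq0.
apply: lerD.
  by rewrite -[d *+ _]mulr_natr ler_wpM2l // ler_nat (leq_trans (max_card _)) // card_ord.
apply: le_trans (ler_norm _) _; rewrite normrM; apply: ler_pM => //.
rewrite normrM norm_spin mul1r; apply: le_trans (ler_normB _ _) _.
by rewrite norm_spin.
Qed.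

Definition flip i s : labelling n := [ffun k => if k == i then ~~ s k else s k].

Lemma flipK i : involutive (flip i).
Proof. by move=> s; apply/ffunP => k; rewrite !ffunE; case: (k == i); rewrite ?negbK. Qed.

Lemma spin_flip i s k : spin (flip i s) k = (if k == i then -1 else 1) * spin s k.
Proof.
by rewrite /spin ffunE; case: (k == i); case: (s k) => /=; ring.
Qed.

(** For distinct [i] and [j], flipping the label of [i] changes the sign of every summand. *)
Lemma sum_spin_pair i j : \sum_(s : labelling n) spin s i * spin s j =
  (i == j)%:R * 2 ^+ n.
Proof.
have [<-|ij] := eqVneq i j.
  under eq_bigr do rewrite spin_sqr.
  by rewrite sumr_const card_ffun card_bool card_ord mul1r natrX.
set X := \sum_s _; have : X = - X.
  rewrite {1}/X (reindex_inj (inv_inj (@flipK i))) /= -sumrN.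
  apply: eq_bigr => s _; rewrite !spin_flip eqxx eq_sym (negPf ij) mul1r mulN1r.
  by rewrite mulNr.
by move/eqP; rewrite -subr_eq0 opprK -mulr2n mulrn_eq0 /= => /eqP->; rewrite mul0r.
Qed.

Lemma sum_imbalance_sqr : \sum_(s : labelling n) imbalance s ^+ 2 = n%:R * 2 ^+ n.
Proof.
transitivity (\sum_(s : labelling n) \sum_i \sum_j spin s i * spin s j).
  apply: eq_bigr => s _; rewrite /imbalance real_normK ?num_real // expr2 mulr_suml.
  by apply: eq_bigr => i _; rewrite mulr_sumr.
rewrite exchange_big /=.
transitivity (\sum_(i < n) 2 ^+ n : R); last by rewrite sumr_const card_ord mulr_natl.
apply: eq_bigr => i _; rewrite exchange_big /= (bigD1 i) //= sum_spin_pair eqxx mul1r.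
by rewrite big1 ?addr0 // => j ji; rewrite sum_spin_pair eq_sym (negPf ji) mul0r.
Qed.

(** Chebyshev's inequality: distinct spins are uncorrelated, so the second moment is [n]. *)
Lemma imbalance_pr (a : R) : 0 < a ->
  \sum_(s : labelling n | a <= imbalance s) (2 ^+ n)^-1 <= n%:R / a ^+ 2.
Proof.
move=> a0; rewrite ler_pdivlMr ?exprn_gt0 // mulr_suml.
have -> : n%:R = \sum_(s : labelling n) (2 ^+ n)^-1 * imbalance s ^+ 2 :> R.
  by rewrite -mulr_sumr sum_imbalance_sqr mulrCA mulVf ?mulr1 // expf_neq0 // pnatr_eq0.
rewrite big_mkcond; apply: ler_sum => s _; case: ifP => [le|_].
  apply: ler_wpM2l; first by rewrite invr_ge0 exprn_ge0.
  by apply: lerXn2r => //; rewrite nnegrE ?normr_ge0 // ltW.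
by rewrite mulr_ge0 ?invr_ge0 ?exprn_ge0 ?normr_ge0.
Qed.

Lemma edge_prob_bounds d lambda s (e : edge 'I_n) :
  0 <= d -> `|lambda| <= Num.sqrt d -> 2 * d <= n%:R ->
  0 <= edge_prob d lambda s e <= 1 /\ edge_prob d lambda s e <= 2 * d / n%:R.
Proof.
move=> d0 ld dn.
have ldd : `|lambda * Num.sqrt d| <= d.
  rewrite normrM (ger0_norm (sqrtr_ge0 _)) -[leRHS](sqr_sqrtr d0) expr2.
  by rewrite ler_wpM2r // sqrtr_ge0.
have [n0|n0] := posnP n.
  by have [x _] := edgeP e; move: (ltn_ord x); rewrite {2}n0.
have nR : 0 < n%:R :> R by rewrite ltr0n.
move: ldd; rewrite ler_norml => /andP[l1 l2].
have [lo up] : 0 <= (if monochromatic s e then d + lambda * Num.sqrt d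
    else d - lambda * Num.sqrt d) /\ (if monochromatic s e then d + lambda * Num.sqrt d
    else d - lambda * Num.sqrt d) <= 2 * d.
  by case: ifP => _; split; lra.
have le2 : edge_prob d lambda s e <= 2 * d / n%:R.
  by rewrite /edge_prob; apply: ler_wpM2r up; rewrite invr_ge0 ltW.
split=> //; apply/andP; split; first by apply: divr_ge0 lo _; apply: ltW.
by apply: le_trans le2 _; rewrite ler_pdivrMr // mul1r.
Qed.

Lemma sbm_prE d lambda (Z : graph 'I_n -> Prop) :
  sbm_pr d lambda Z =
  \sum_(s : labelling n) (2 ^+ n)^-1 * bernoulli_pr (edge_prob d lambda s) Z.
Proof. by apply: eq_bigr => s _; rewrite mulr_sumr. Qed.

Lemma sbm_prC d lambda (Z : graph 'I_n -> Prop) :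
  sbm_pr d lambda Z = 1 - sbm_pr d lambda (fun G => ~ Z G).
Proof.
rewrite -(@sbm_pr_true R n d lambda) /sbm_pr -sumrB; apply: eq_bigr => s _.
rewrite [X in _ = X - _](bigID (fun G => `[< Z G >])) /= -addrA -[LHS]addr0.
congr (_ + _); first by apply: eq_bigl => G; rewrite (asboolT Logic.I).
apply/esym/eqP; rewrite subr_eq0; apply/eqP/eq_bigl => G.
by rewrite (asboolT Logic.I) /= asbool_neg.
Qed.

Lemma bernoulli_pr_le1 (E : finType) (p : E -> R) (Z : {set E} -> Prop) :
  (forall e, 0 <= p e <= 1) -> bernoulli_pr p Z <= 1.
Proof.
move=> p01; have := bernoulli_transform p (fun=> 1) set0.
rewrite [RHS in _ = RHS -> _]big1 => [<-|e _]; last by rewrite inE subrr mulr0 addr0.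
rewrite bernoulli_prE; apply: ler_sum => G _.
rewrite sub0set mul1r big1 // mulr1 ler_piMl ?bernoulli_mass_ge0 //.
by case: asboolP.
Qed.

(** Labellings of imbalance at least [a] are charged probability 1, which costs the Chebyshev
    term. *)
Lemma sbm_pr_le d lambda (Z : graph 'I_n -> Prop) (a c : R) :
  0 <= d -> `|lambda| <= Num.sqrt d -> 2 * d <= n%:R -> 0 < a -> 0 <= c ->
  (forall s, imbalance s < a -> bernoulli_pr (edge_prob d lambda s) Z <= c) ->
  0 <= sbm_pr d lambda Z <= c + n%:R / a ^+ 2.
Proof.
move=> d0 ld dn a0 c0 Zc.
have p01 s e : 0 <= edge_prob d lambda s e <= 1 by case: (edge_prob_bounds s e d0 ld dn).
have i0 : 0 <= (2 ^+ n)^-1 :> R by rewrite invr_ge0 exprn_ge0.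
rewrite sbm_prE sumr_ge0 => [|s _]; last by rewrite mulr_ge0 ?bernoulli_pr_ge0.
rewrite (bigID (fun s => a <= imbalance s)) /= addrC; apply: lerD; last first.
  apply: le_trans (imbalance_pr a0); apply: ler_sum => s _.
  by rewrite -[leRHS]mulr1 ler_wpM2l // bernoulli_pr_le1.
apply: (@le_trans _ _ (\sum_(s : labelling n) (2 ^+ n)^-1 * c)).
  rewrite [leRHS](bigID (fun s => a <= imbalance s)) /= addrC -[leLHS]addr0.
  apply: lerD; last by apply: sumr_ge0 => s _; apply: mulr_ge0.
  by apply: ler_sum => s; rewrite -ltNge => /Zc; apply: ler_wpM2l.
by rewrite sumr_const card_ffun card_bool card_ord -[leLHS]mulr_natl natrX mulrA divff ?mul1r // expf_neq0 // pnatr_eq0.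
Qed.

End Labels.

(** * Events of vanishing probability *)

Section NegligibleEvents.
Variables (R : realType) (d lambda nu : R).
Hypotheses (d1 : 1 <= d) (ld : `|lambda| <= Num.sqrt d) (nu0 : 0 < nu).
Implicit Types (Bad : forall n, graph 'I_n -> Prop) (c eta theta b kappa : R).

Let dd := d * (1 + nu).
Let d0 : 0 <= d. Proof. by move: d1; lra. Qed.
Let dd0 : 0 <= dd. Proof. by rewrite mulr_ge0 // addr_ge0 // ltW. Qed.

(* Smallness is uniform over the nearly balanced labellings, for which every vertex
   has expected degree at most dd (p_deg). *)
Definition negligible Bad : Prop := forall eta, 0 < eta -> exists N, forall n, (N <= n)%N ->
  forall s : labelling n, imbalance R s < nu * n%:R - 1 ->
  bernoulli_pr (edge_prob d lambda s) (@Bad n) <= eta.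

Lemma eventually_le (x : R) : exists N, forall n, (N <= n)%N -> x <= n%:R.
Proof.
exists (Num.truncn x).+1 => n Nn.
apply: le_trans (_ : (Num.truncn x).+1%:R <= _); last by rewrite ler_nat.
by apply/ltW/truncnS_gt.
Qed.

Lemma eventually_ln (x : R) : exists N, forall n, (N <= n)%N -> (0 < n)%N /\ x <= ln n%:R.
Proof.
have [N NP] := eventually_le (expR x); exists (maxn 1 N) => n.
rewrite geq_max => /andP[n0 /NP le]; split=> //.
by rewrite -(expRK x) ler_ln ?posrE ?expR_gt0 // ltr0n.
Qed.

Let p01 n (s : labelling n) : 2 * d <= n%:R -> forall e, 0 <= edge_prob d lambda s e <= 1.
Proof. by move=> dn e; case: (edge_prob_bounds s e d0 ld dn). Qed.

Let p_le n (s : labelling n) : 2 * d <= n%:R -> forall e, edge_prob d lambda s e <= 2 * d / n%:R.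
Proof. by move=> dn e; case: (edge_prob_bounds s e d0 ld dn). Qed.

Let p_deg n (s : labelling n) : (0 < n)%N -> imbalance R s < nu * n%:R - 1 ->
  forall u : 'I_n, \sum_(e : edge 'I_n | u \in val e) edge_prob d lambda s e <= dd.
Proof.
move=> n0 sb u; apply: le_trans (sum_edge_prob s u d0 ld) _.
by rewrite ler_wpM2l // lerD2l ler_pdivrMr ?ltr0n // -lerBrDr ltW.
Qed.

Lemma negligible_sub N Bad Bad' :
  (forall n (G : graph 'I_n), (N <= n)%N -> Bad n G -> Bad' n G) ->
  negligible Bad' -> negligible Bad.
Proof.
move=> sub nB eta eta0; have [N1 N1P] := nB eta eta0; have [N2 N2P] := eventually_le (2 * d).
exists (maxn N (maxn N1 N2)) => n; rewrite !geq_max => /and3P[Nn N1n N2n] s sb.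
apply: le_trans (N1P n N1n s sb); apply: le_bernoulli_pr; first by apply/p01/N2P.
by move=> G; apply: sub.
Qed.

Lemma negligible_or Bad Bad' : negligible Bad -> negligible Bad' ->
  negligible (fun n G => Bad n G \/ Bad' n G).
Proof.
move=> nB nB' eta eta0; have e2 : 0 < eta / 2 by lra.
have [N1 N1P] := nB _ e2; have [N2 N2P] := nB' _ e2.
have [N3 N3P] := eventually_le (2 * d).
exists (maxn N1 (maxn N2 N3)) => n; rewrite !geq_max => /and3P[N1n N2n N3n] s sb.
apply: le_trans (bernoulli_pr_or _ _ _) _; first by apply/p01/N3P.
have := N1P n N1n s sb; have := N2P n N2n s sb; lra.
Qed.

Lemma negligible_bound Bad (C : R) : 0 <= C ->
  (exists N, forall n, (N <= n)%N -> (0 < n)%N -> 2 * d <= n%:R ->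
     forall s : labelling n, imbalance R s < nu * n%:R - 1 ->
     bernoulli_pr (edge_prob d lambda s) (@Bad n) <= C * expR (- (ln n%:R / 2))) ->
  negligible Bad.
Proof.
move=> C0 [N NP] eta eta0; have [N1 N1P] := eventually_ln (2 * (C / eta)).
have [N2 N2P] := eventually_le (2 * d).
exists (maxn N (maxn N1 N2)) => n; rewrite !geq_max => /and3P[Nn N1n N2n] s sb.
have [n0 lnn] := N1P n N1n.
apply: le_trans (NP n Nn n0 (N2P n N2n) s sb) _.
rewrite expRN ler_pdivrMr ?expR_gt0 //.
apply: (@le_trans _ _ (eta * (1 + C / eta))).
  by rewrite mulrDr mulr1 mulrCA mulfV ?gt_eqF // mulr1 lerDr ltW.
rewrite ler_pM2l //; apply: le_trans (expR_ge1Dx _) _; rewrite ler_expR; lra.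
Qed.

Lemma expR_ln_nat n : (0 < n)%N -> n%:R = expR (ln n%:R) :> R.
Proof. by move=> n0; rewrite lnK // posrE ltr0n. Qed.

(** The mean degrees over [A] are absorbed by [b], and each vertex of [W] gains [theta * kappa]
    against the cost [4 + ln d + 2 * theta] of trees and subsets. For [c0 * ln n%:R] vertices the
    net gain is [n] to the power -3, enough for the factor [n] of the tree count and the sum over
    sizes. *)
Lemma excess_negligible (K : nat -> nat) theta b kappa c0 :
  0 <= theta -> 0 <= c0 ->
  (forall n, (0 < K n)%N /\ ((0 < n)%N -> c0 * ln n%:R <= (K n)%:R)) ->
  dd * ((expR (2 * theta) - 1) / 2) <= theta * b ->
  3 <= c0 * (theta * kappa - (4 + ln d + 2 * theta)) ->
  negligible (fun n G => ~ sparse_excess G (K n) b kappa).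
Proof.
move=> t0 c00 KP tb tk; apply: (@negligible_bound _ 2) => //.
exists 0%N => n _ n0 dn s sb.
have [K0 /(_ n0) Kln] := KP n.
have q0 : 0 <= 2 * d / n%:R by rewrite divr_ge0 // mulr_ge0.
have ln0 : 0 <= ln n%:R :> R by rewrite ln_ge0 // ler1n.
pose Z (i : 'I_n.+1) (G : graph 'I_n) := exists W A : {set 'I_n},
  [/\ connected_set G W, #|W| = i, A \subset W &
    b * #|A|%:R + kappa * i%:R <= (\sum_(u in A) degree G u)%:R].
apply: (@le_trans _ _ (bernoulli_pr (edge_prob d lambda s)
    (fun G => exists2 i : 'I_n.+1, (K n <= i)%N & Z i G))).
  apply: le_bernoulli_pr; first exact: p01.
  move=> G nE; apply: contrapT => nZ; apply: nE => W A cW KW AW.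
  rewrite ltNge; apply/negP => le; apply: nZ.
  have Wn : (#|W| < n.+1)%N by rewrite ltnS -[leqRHS]card_ord max_card.
  by exists (Ordinal Wn) => //; exists W, A; split=> //; rewrite natr_sum.
have key : forall i : 'I_n.+1, (K n <= i)%N ->
    bernoulli_pr (edge_prob d lambda s) (Z i) <= n%:R * expR (- (3 * ln n%:R)).
  move=> i Ki; have i0 : (0 < i)%N by apply: leq_trans Ki.
  have B0 : dd * ((expR (2 * theta) - 1) / 2) - theta * b <= 0 by rewrite subr_le0.
  have := connected_excess_pr (p01 s dn) q0 (p_le s dn) (p_deg n0 sb)
    (kappa * i%:R) i0 t0 B0 (lexx 0).
  rewrite card_ord => /le_trans; apply.
  apply: le_trans (tree_count_le _ _ n0 i0 d1 t0) _.
  apply: ler_wpM2l => //; rewrite ler_expR.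
  have Ki' : c0 * ln n%:R <= i%:R by apply: le_trans Kln _; rewrite ler_nat.
  set g := theta * kappa - (4 + ln d + 2 * theta) in tk.
  have g0 : 0 <= g.
    rewrite leNgt; apply/negP => g0.
    by have := mulr_ge0_le0 c00 (ltW g0); move: tk; lra.
  rewrite (_ : _ - _ = - (i%:R * g)); last by rewrite /g; ring.
  rewrite lerN2; apply: le_trans (ler_wpM2r g0 Ki'); rewrite mulrAC.
  exact: ler_wpM2r.
apply: le_trans (bernoulli_pr_exists (p01 s dn) key) _.
apply: (@le_trans _ _ ((2 * n%:R) * (n%:R * expR (- (3 * ln n%:R))))).
  apply: ler_wpM2r; first by rewrite mulr_ge0 ?expR_ge0.
  rewrite -natrM ler_nat; apply: leq_trans (max_card _) _.
  by rewrite card_ord mul2n -addnn; move: n0; clear; lia.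
rewrite -mulrA; apply: ler_wpM2l => //.
rewrite {1 2}(expR_ln_nat n0) -!expRD ler_expR; move: ln0; lra.
Qed.

(** Taken with [A = W] and no mean subtracted: [M] is the full cost per vertex, affordable for
    [c' * ln n%:R] vertices. The successor on the degree sum matches [card_gballS]. *)
Lemma small_sets_negligible theta c c' :
  let M := 4 + ln d + 2 * theta + dd * ((expR (2 * theta) - 1) / 2) in
  0 <= theta -> 0 <= c' -> 3 + M * c' <= theta * c ->
  negligible (fun n G => exists W : {set 'I_n}, [/\ connected_set G W, (0 < #|W|)%N,
    #|W|%:R <= c' * ln n%:R + 1 & c * ln n%:R <= (\sum_(u in W) degree G u).+1%:R]).
Proof.
move=> M t0 c'0 tc.
have B0 : 0 <= dd * ((expR (2 * theta) - 1) / 2).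
  by apply: mulr_ge0 => //; rewrite divr_ge0 // subr_ge0 expR_ge1_nneg // mulr_ge0.
have lnd0 : 0 <= ln d by apply: ln_ge0.
have M0 : 0 <= M by rewrite /M; move: t0 B0 lnd0; lra.
apply: (@negligible_bound _ (2 * expR (M + theta))); first by rewrite mulr_ge0 ?expR_ge0.
exists 0%N => n _ n0 dn s sb.
have q0 : 0 <= 2 * d / n%:R by rewrite divr_ge0 // mulr_ge0.
have ln0 : 0 <= ln n%:R :> R by rewrite ln_ge0 // ler1n.
pose Z (i : 'I_n.+1) (G : graph 'I_n) := exists W A : {set 'I_n},
  [/\ connected_set G W, #|W| = i, A \subset W &
    0 * #|A|%:R + (c * ln n%:R - 1) <= (\sum_(u in A) degree G u)%:R].
pose P (i : 'I_n.+1) := (0 < i)%N && (i%:R <= c' * ln n%:R + 1).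
apply: (@le_trans _ _ (bernoulli_pr (edge_prob d lambda s)
    (fun G => exists2 i : 'I_n.+1, P i & Z i G))).
  apply: le_bernoulli_pr; first exact: p01.
  move=> G [W [cW W0 Wc le]].
  have Wn : (#|W| < n.+1)%N by rewrite ltnS -[leqRHS]card_ord max_card.
  exists (Ordinal Wn); first by rewrite /P /= W0 Wc.
  by exists W, W; split=> //; rewrite mul0r add0r lerBlDr natr1.
have key : forall i : 'I_n.+1, P i ->
    bernoulli_pr (edge_prob d lambda s) (Z i) <= n%:R * expR (M + theta - 3 * ln n%:R).
  move=> i /andP[i0 ic].
  have B1 : dd * ((expR (2 * theta) - 1) / 2) - theta * 0 <= dd * ((expR (2 * theta) - 1) / 2).
    by rewrite mulr0 subr0.
  have := connected_excess_pr (p01 s dn) q0 (p_le s dn) (p_deg n0 sb)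
    (c * ln n%:R - 1) i0 t0 B1 B0.
  rewrite card_ord => /le_trans; apply.
  apply: le_trans (tree_count_le _ _ n0 i0 d1 t0) _.
  apply: ler_wpM2l => //; rewrite ler_expR -/M.
  apply: (@le_trans _ _ ((c' * ln n%:R + 1) * M - theta * (c * ln n%:R - 1))).
    by rewrite lerD2r ler_wpM2r.
  have := ler_wpM2r ln0 tc; lra.
apply: le_trans (bernoulli_pr_exists (p01 s dn) key) _.
apply: (@le_trans _ _ ((2 * n%:R) * (n%:R * expR (M + theta - 3 * ln n%:R)))).
  apply: ler_wpM2r; first by rewrite mulr_ge0 ?expR_ge0.
  rewrite -natrM ler_nat; apply: leq_trans (max_card _) _.
  by rewrite card_ord mul2n -addnn; move: n0; clear; lia.
rewrite -!mulrA; apply: ler_wpM2l => //.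
rewrite {1 2}(expR_ln_nat n0) -!expRD ler_expR; move: ln0; lra.
Qed.

(** The number of sizes is at most [expR (1 + (5 * K n)%:R)], which raises [7 + ln d] to [8 + ln d].
    The condition on [c0] spends at most half of the exponent in the factor [1 / n]. *)
Lemma bicycle_negligible (K : nat -> nat) c0 : 0 <= c0 ->
  (forall n, (0 < n)%N -> (K n)%:R <= c0 * ln n%:R + 1) ->
  5 * (8 + ln d) * c0 <= 1 / 2 ->
  negligible (fun n G => ~ no_bicycle G (5 * K n)).
Proof.
move=> c00 KP cd.
have lnd0 : 0 <= ln d by apply: ln_ge0.
apply: (@negligible_bound _ (2 * d * expR (5 * (8 + ln d) + 1))).
  by rewrite !mulr_ge0 ?expR_ge0.
exists 0%N => n _ n0 dn s sb.
have q0 : 0 <= 2 * d / n%:R by rewrite divr_ge0 // mulr_ge0.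
have ln0 : 0 <= ln n%:R :> R by rewrite ln_ge0 // ler1n.
have Kln := KP n n0.
pose Z (i : 'I_(5 * K n).+1) (G : graph 'I_n) := exists W : {set 'I_n},
  #|W| = i /\ exists e f : edge 'I_n,
    [/\ e \in G, f \in G, e != f, val e \subset W & val f \subset W] /\
    connected_set (G :\ e :\ f) W.
apply: (@le_trans _ _ (bernoulli_pr (edge_prob d lambda s)
    (fun G => exists2 i : 'I_(5 * K n).+1, (0 < i)%N & Z i G))).
  apply: le_bernoulli_pr; first exact: p01.
  move=> G nE; apply: contrapT => nZ; apply: nE => W e f WK eG fG ef eW fW cW.
  apply: nZ; have Wn : (#|W| < (5 * K n).+1)%N by [].
  exists (Ordinal Wn).
    apply: leq_trans (subset_leq_card eW); by rewrite (eqP (valP e)).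
  by exists W; split=> //; exists e, f.
have key : forall i : 'I_(5 * K n).+1, (0 < i)%N ->
    bernoulli_pr (edge_prob d lambda s) (Z i) <=
    2 * d / n%:R * expR ((5 * K n)%:R * (7 + ln d)).
  move=> i i0.
  have := bicycle_pr (p01 s dn) q0 (p_le s dn) (p_deg n0 sb) i0.
  rewrite card_ord => /le_trans; apply.
  apply: le_trans (bicycle_count_le _ n0 d1) _.
  apply: ler_wpM2l => //; rewrite ler_expR ler_wpM2r ?ler_nat -1?ltnS //.
  by move: lnd0; lra.
apply: le_trans (bernoulli_pr_exists (p01 s dn) key) _.
apply: (@le_trans _ _ (expR (1 + (5 * K n)%:R) *
    (2 * d / n%:R * expR ((5 * K n)%:R * (7 + ln d))))).
  apply: ler_wpM2r; first by rewrite mulr_ge0 ?expR_ge0.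
  apply: (@le_trans _ _ (5 * K n).+1%:R).
    by rewrite ler_nat; apply: leq_trans (max_card _) _; rewrite card_ord.
  by apply: le_trans (nat_le_pow2 _ _) _; apply: le_trans (pow2_le_expR _ _) _; rewrite -nat1r.
have ninv : n%:R^-1 = expR (- ln n%:R) :> R by rewrite expRN -expR_ln_nat.
rewrite ninv mulrCA -!mulrA; apply: ler_wpM2l => //.
apply: ler_wpM2l => //; rewrite -!expRD ler_expR natrM.
set k := (K n)%:R in Kln *; set L := ln d in cd lnd0 *; set x := ln n%:R in ln0 Kln *.
have : k * (5 * (8 + L)) <= (c0 * x + 1) * (5 * (8 + L)).
  by apply: ler_wpM2r => //; move: lnd0; lra.
have := ler_wpM2r ln0 cd; lra.
Qed.

End NegligibleEvents.

(** * Growth of balls *)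

Section BallGrowth.
Variables (R : realType) (d lambda nu : R).
Hypotheses (d1 : 1 <= d) (ld : `|lambda| <= Num.sqrt d) (nu0 : 0 < nu).

Lemma negligible_False : negligible d lambda nu (fun n G => False).
Proof.
move=> eta eta0; exists 0%N => n _ s _.
by rewrite bernoulli_pr0 ?ltW // => G.
Qed.

(* Each step of the induction lowers the scale from c to c': a ball of size c' ln n
   cannot grow to c ln n in one step. *)
Lemma ball_negligible J (c : R) : 0 < c ->
  negligible d lambda nu (fun n G => ~ forall (u : 'I_n) j, (j <= J)%N ->
    #|gball G u j|%:R <= c * ln n%:R).
Proof.
elim: J c => [|J IH] c c0.
  have [N NP] := eventually_ln (c^-1).
  apply: (negligible_sub d1 ld (N := N) _ negligible_False) => n G /NP[n0 lnn]; apply=> u j.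
  rewrite leqn0 => /eqP->; rewrite gball0 cards1.
  by have := ler_wpM2l (ltW c0) lnn; rewrite mulfV ?lt0r_neq0.
(* Then [theta * c = 5], while [c'] below is chosen with [M * c' <= 1]. *)
pose theta := 5 / c; have t0 : 0 <= theta by rewrite divr_ge0 // ltW.
pose M := 4 + ln d + 2 * theta + d * (1 + nu) * ((expR (2 * theta) - 1) / 2).
have M0 : 0 <= M.
  have B0 : 0 <= (expR (2 * theta) - 1) / 2.
    by rewrite divr_ge0 // subr_ge0 expR_ge1_nneg // mulr_ge0.
  have : 0 <= d * (1 + nu) * ((expR (2 * theta) - 1) / 2).
    by apply: mulr_ge0 B0; apply: mulr_ge0; move: d1 nu0; lra.
  by have := ln_ge0 d1; rewrite /M; move: t0; lra.
pose c' := Num.min c (M + 1)^-1.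
have M1 : 0 < M + 1 by lra.
have c'0 : 0 < c' by rewrite lt_min c0 invr_gt0.
have Mc' : M * c' <= 1.
  apply: (@le_trans _ _ ((M + 1) * (M + 1)^-1)); last by rewrite mulfV // gt_eqF.
  by apply: ler_pM => //; [exact: ltW | lra | rewrite ge_min lexx orbT].
have tc : 3 + M * c' <= theta * c by rewrite /theta mulfVK ?gt_eqF //; lra.
have neg := negligible_or d1 ld (IH c' c'0)
  (small_sets_negligible d1 ld nu0 t0 (ltW c'0) tc).
apply: (negligible_sub d1 ld (N := 1) _ neg) => n G n0 nball.
have ln0 : 0 <= ln n%:R :> R by rewrite ln_ge0 // ler1n.
apply: contrapT => /not_orP[/contrapT ball small]; apply: nball => u j.
rewrite leq_eqVlt ltnS => /orP[/eqP->|jJ]; last first.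
  apply: le_trans (ball u j jJ) _; apply: ler_wpM2r => //.
  by rewrite ge_min lexx.
rewrite leNgt; apply/negP => lt; apply: small; exists (gball G u J); split.
- exact: connected_ball.
- by apply/card_gt0P; exists u; apply/gballP; exists [::].
- by apply: le_trans (ball u J (leqnn _)) _; rewrite lerDl.
by apply: le_trans (ltW lt) _; rewrite ler_nat card_gballS.
Qed.

(** Up to radius [J] balls have at most [x] vertices. Beyond, a ball with at least [K] vertices
    grows by a factor at most [b + kappa + 1] by [sparse_excess], and after a smaller one the next
    ball has at most [C] vertices, already below [D ^+ J * x]. *)
Lemma ball_bound (V : finType) (G : graph V) (K J : nat) (b kappa D x C : R) :
  (0 < J)%N -> 1 <= D -> 0 <= x -> b + kappa + 1 <= D -> C <= D ^+ J * x ->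
  sparse_excess G K b kappa ->
  (forall (W : {set V}), connected_set G W -> (0 < #|W| < K)%N ->
     (\sum_(u in W) degree G u).+1%:R <= C) ->
  (forall (u : V) j, (j <= J)%N -> #|gball G u j|%:R <= x) ->
  forall (u : V) r, (1 <= r)%N -> #|gball G u r|%:R <= D ^+ (r - 1) * x.
Proof.
move=> J0 D1 x0 bD CD E2 small ball u r.
have D0 : 0 <= D by lra.
have Dp k : 1 <= D ^+ k by apply: exprn_ege1.
elim: r => // r IH _; rewrite subn1 /=.
have [rJ|Jr] := ltnP r J.
  by apply: le_trans (ball u _ rJ) _; rewrite ler_peMl.
have r0 : (0 < r)%N by apply: leq_trans Jr.
have uB : (0 < #|gball G u r|)%N by apply/card_gt0P; exists u; apply/gballP; exists [::].
have cB := @connected_ball V G u r.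
apply: le_trans (_ : (\sum_(y in gball G u r) degree G y).+1%:R <= _).
  by rewrite ler_nat card_gballS.
have [Kr|rK] := leqP K #|gball G u r|; last first.
  apply: le_trans (small _ cB _) _; first by rewrite uB.
  by apply: le_trans CD _; rewrite ler_wpM2r // ler_weXn2l.
have /ltW := E2 _ _ cB Kr (subxx _); rewrite -natr_sum => le.
apply: (@le_trans _ _ (D * #|gball G u r|%:R)).
  apply: (@le_trans _ _ ((b + kappa + 1) * #|gball G u r|%:R)); last by rewrite ler_wpM2r.
  have : 1 <= #|gball G u r|%:R :> R by rewrite ler1n.
  rewrite -natr1; move: le; lra.
have -> : D ^+ r = D * D ^+ (r - 1) by rewrite -exprS subn1 prednK.
by rewrite -mulrA; apply: ler_wpM2l (IH r0).
Qed.

End BallGrowth.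

(** * Choice of parameters *)

Section WithHighProbability.
Variables (R : realType) (d lambda eps : R).
Hypotheses (d1 : 1 <= d) (ld : `|lambda| <= Num.sqrt d) (eps0 : 0 < eps).

Let rho := eps / (8 + eps).
Let theta := rho / 4.
(** This is [(s - b) / 22], the largest value that [good_splitting] admits. *)
Let kappa := eps * d / 176.

Hypothesis eps_large : 250 * (1 + ln d) <= theta * kappa.

Let b := (1 + eps / 4) * d.
Let s := (1 + 3 * eps / 8) * d.
Let D := (1 + eps) * d.

Lemma rho_bounds : 0 < rho < 1.
Proof.
by rewrite divr_gt0 /= ?ltr_pdivrMr; move: eps0; lra.
Qed.

(* rho is chosen so that b = d * (1 + eps / 8) * (1 + rho). *)
Lemma tilt_mean_le : d * (1 + eps / 8) * ((expR (2 * theta) - 1) / 2) <= theta * b.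
Proof.
have /andP[r0 r1] := rho_bounds.
have : expR (2 * theta) - 1 <= 2 * theta * (1 + rho).
  rewrite lerBlDr -[expR _]invrK -expRN.
  apply: (@le_trans _ _ (1 - 2 * theta)^-1).
    by rewrite lef_pV2 ?posrE ?expR_gt0 ?expR_ge1Dx //; rewrite /theta; lra.
  rewrite -[leLHS]mul1r ler_pdivrMr; last by rewrite /theta; lra.
  rewrite /theta; have := ler_wpM2l (ltW r0) (ltW r1); have := sqr_ge0 rho; nra.
move=> le.
have bE : b = d * (1 + eps / 8) * (1 + rho).
  by rewrite /b /rho; field; apply: lt0r_neq0; move: eps0; lra.
have e0 : 0 <= d * (1 + eps / 8) by apply: mulr_ge0; move: d1 eps0; lra.
rewrite bE; apply: le_trans (ler_wpM2l e0 (_ : _ <= theta * (1 + rho))) _; first by lra.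
by rewrite mulrCA.
Qed.

Lemma eps_d_large : 4 <= eps * d.
Proof.
have /andP[r0 r1] := rho_bounds.
have t0 : 0 <= theta by rewrite /theta; lra.
have lnd0 := ln_ge0 d1; move: eps_large.
have k0 : 0 <= kappa by rewrite /kappa divr_ge0 // mulr_ge0 //; move: d1 eps0; lra.
have : theta * kappa <= 1 * kappa by apply: ler_wpM2r => //; rewrite /theta; lra.
by rewrite /kappa; lra.
Qed.

(* This needs eps * d >= 4, the slack between s ^ 2 and b * D being of order
   eps * d ^ 2. *)
Lemma s_sqr_le : s ^+ 2 <= b * (D - 1).
Proof.
have y4 := eps_d_large.
rewrite -subr_ge0 (_ : _ - _ =
  d * ((eps * d - 4) * (1 / 2 + 7 / 64 * eps) + 1 + 3 / 16 * eps)); last first.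
  by rewrite /s /b /D; field.
apply: mulr_ge0; first by move: d1; lra.
rewrite !addr_ge0 ?mulr_ge0 //; move: y4 eps0; lra.
Qed.

(** Small enough for [5 * (8 + ln d) * c0 <= 1 / 2], which excludes bicycles, and large enough for
    [3 <= c0 * (245 * (1 + ln d))], which the excess estimate needs. *)
Let c0 := (80 * (1 + ln d))^-1.
Let K n := (Num.truncn (c0 * ln n%:R)).+1.

Lemma good_decomposition_negligible (delta : R) : 0 < delta ->
  negligible d lambda (eps / 8) (fun n G => ~ good_decomposition d eps (delta * ln n%:R) G).
Proof.
move=> delta0.
have lnd0 := ln_ge0 d1.
have /andP[r0 r1] := rho_bounds.
have t0 : 0 <= theta by rewrite /theta; lra.
have t1 : theta <= 1 / 4 by rewrite /theta; lra.
have nu0 : 0 < eps / 8 by move: eps0; lra.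
have L0 : 0 < 1 + ln d by lra.
have c00 : 0 < c0 by rewrite invr_gt0; lra.
have c0L : c0 * (80 * (1 + ln d)) = 1 by rewrite mulVf // gt_eqF //; lra.
have neg1 : negligible d lambda (eps / 8) (fun n G => ~ no_bicycle G (5 * K n)).
  apply: (bicycle_negligible (eps / 8) d1 ld (K := K) (ltW c00)) => [n n0|].
    rewrite /K -natr1 lerD2r truncn_le //; apply: mulr_ge0; first exact: ltW.
    by rewrite ln_ge0 // ler1n.
  have := mulr_ge0 (ltW c00) lnd0; move: c0L; lra.
have neg2 : negligible d lambda (eps / 8) (fun n G => ~ sparse_excess G (K n) b kappa).
  apply: (excess_negligible (nu := eps / 8) d1 ld (K := K) t0 (ltW c00)).
  - by move=> n; split=> // _; apply/ltW/truncnS_gt.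
  - exact: tilt_mean_le.
  (* The tree cost [4 + ln d + 2 * theta] is at most [5 * (1 + ln d)], which leaves 245 of the 250
     in [eps_large]. *)
  apply: (@le_trans _ _ (c0 * (245 * (1 + ln d)))); first by move: c0L; lra.
  by apply: ler_wpM2l; [exact: ltW | move: eps_large t1; lra].
pose M := 4 + ln d + 2 * 1 + d * (1 + eps / 8) * ((expR (2 * 1) - 1) / 2).
pose C := 3 + M * c0.
have neg3 := small_sets_negligible d1 ld nu0 (theta := 1) (c := C) (c' := c0) ler01 (ltW c00).
have {}neg3 := neg3 (eq_ind_r (fun z => _ <= z) (lexx _) (mul1r _)).
have D2 : 2 <= D by have := eps_d_large; rewrite /D mulrDl mul1r; move: d1; lra.
(* As [D >= 2], the power [D ^+ J] is at least [J], hence at least [C / delta]. *)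
have [J0 J0P] := eventually_le (C / delta).
pose J := J0.+1.
have CJ : C <= D ^+ J * delta.
  rewrite -ler_pdivrMr //; apply: le_trans (J0P J (leqnSn _)) _.
  apply: le_trans (nat_le_pow2 _ _) _.
  by apply: lerXn2r; rewrite ?nnegrE //; move: D2; lra.
have neg4 := ball_negligible d1 ld nu0 J delta0.
have [N NP] := eventually_ln (c0^-1).
have neg := negligible_or d1 ld (negligible_or d1 ld neg1 neg2) (negligible_or d1 ld neg3 neg4).
apply: (negligible_sub d1 ld (N := N) _ neg) => n G /NP[n0 lnn] bad.
have ln0 : 0 <= ln n%:R :> R by rewrite ln_ge0 // ler1n.
apply: contrapT => /not_orP[/not_orP[/contrapT nb /contrapT E2] /not_orP[small /contrapT ball]].
apply: bad.
have Kln : (K n)%:R <= c0 * ln n%:R + 1.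
  by rewrite /K -natr1 lerD2r truncn_le //; apply: mulr_ge0 => //; exact: ltW.
have y4 := eps_d_large.
have balls : forall (u : 'I_n) r, (1 <= r)%N -> #|gball G u r|%:R <= D ^+ (r - 1) * (delta * ln n%:R).
  apply: (@ball_bound _ _ G (K n) J b kappa D (delta * ln n%:R) (C * ln n%:R)) => //.
  - by move: D2; lra.
  - by rewrite mulr_ge0 // ltW.
  - by rewrite /b /kappa /D; move: y4; lra.
  - by rewrite mulrA ler_wpM2r.
  move=> W cW /andP[W0 WK]; rewrite leNgt; apply/negP => lt; apply: small.
  exists W; split=> //; last exact: ltW.
  by apply: le_trans Kln; rewrite ler_nat ltnW.
have K1 : (1 < K n)%N.
  rewrite /K ltnS lt0n; apply/eqP => tr0.
  have := truncnS_gt (c0 * ln n%:R); rewrite tr0 ltNge => /negP; apply.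
  by have := ler_wpM2l (ltW c00) lnn; rewrite mulfV ?lt0r_neq0.
have b0 : 0 < b by rewrite /b mulr_gt0 //; move: eps0 d1; lra.
have bs : b < s by rewrite /b /s; move: y4; lra.
have sD : s <= D by rewrite /s /D; move: y4; lra.
have ks : kappa <= (s - b) / 22 by rewrite /kappa /s /b; lra.
have [G1 [G2 [GE dis deg nf [P1 P2]]]] := good_splitting b0 bs sD s_sqr_le K1 ks nb E2 balls.
by exists G1, G2; split=> //; split=> r u; [apply: P1 | apply: P2].
Qed.

End WithHighProbability.

(** * Passage to the limit *)

Section Limits.
Variables (R : realType) (d lambda nu : R).
Hypotheses (d1 : 1 <= d) (ld : `|lambda| <= Num.sqrt d) (nu0 : 0 < nu).

Lemma negligible_sbm_pr (Bad : forall n, graph 'I_n -> Prop) :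
  negligible d lambda nu Bad -> forall eta, 0 < eta ->
  exists N, forall n, (N <= n)%N -> 0 <= sbm_pr d lambda (Bad n) <= eta.
Proof.
move=> nB eta eta0; have e2 : 0 < eta / 2 by lra.
have [N1 N1P] := nB _ e2; have [N2 N2P] := eventually_le (2 * d).
have [N3 N3P] := eventually_le (2 / nu).
(* With [nu * n%:R - 1 >= nu * n%:R / 2], this makes the Chebyshev term at most [eta / 2]. *)
have [N4 N4P] := eventually_le (8 / (nu ^+ 2 * eta)).
exists (maxn (maxn N1 N2) (maxn N3 N4)) => n.
rewrite !geq_max -!andbA => /and4P[/N1P N1n /N2P N2n /N3P N3n /N4P N4n].
have n0 : 0 < n%:R :> R by move: N2n d1; lra.
have nn : 2 <= nu * n%:R by rewrite mulrC -ler_pdivrMr.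
have a0 : 0 < nu * n%:R - 1 by lra.
have d0 : 0 <= d by move: d1; lra.
have /andP[-> le] := sbm_pr_le d0 ld N2n a0 (ltW e2) N1n.
apply: le_trans le _.
suff : n%:R / (nu * n%:R - 1) ^+ 2 <= eta / 2 by lra.
rewrite ler_pdivrMr ?exprn_gt0 //.
have le1 : (nu * n%:R / 2) ^+ 2 <= (nu * n%:R - 1) ^+ 2.
  by apply: lerXn2r; rewrite ?nnegrE; lra.
apply: le_trans (ler_wpM2l (ltW e2) le1).
have ne0 : 0 < nu ^+ 2 * eta by rewrite mulr_gt0 // exprn_gt0.
move: N4n; rewrite ler_pdivrMr // => N4n.
rewrite [leRHS](_ : _ = n%:R * (n%:R * (nu ^+ 2 * eta)) / 8); last by field.
have := ler_wpM2l (ltW n0) N4n; lra.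
Qed.

End Limits.

(** Let [N m] be a threshold beyond which [f m] is at most [m.+1%:R^-1], and let [m n] be the
    largest [m <= n] with [N m <= n]. The value 0 of an empty maximum is harmless, since only
    [n >= N 0] matter. *)
Lemma diagonal_sequence (R : realType) (f : nat -> nat -> R) :
  (forall m (eta : R), 0 < eta -> exists N, forall n, (N <= n)%N -> 0 <= f m n <= eta) ->
  exists2 m : nat -> nat, (forall M, exists N, forall n, (N <= n)%N -> (M <= m n)%N) &
    forall eta : R, 0 < eta -> exists N, forall n, (N <= n)%N -> 0 <= f (m n) n <= eta.
Proof.
move=> fP.
have /choice[N NP] : forall m, exists N, forall n, (N <= n)%N -> 0 <= f m n <= m.+1%:R^-1.
  by move=> m; apply: fP; rewrite invr_gt0 ltr0n.
pose m n := (\max_(i < n.+1 | (N i <= n)%N) i)%N.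
have m_large M : exists N', forall n, (N' <= n)%N -> (M <= m n)%N.
  exists (maxn M (N M)) => n; rewrite geq_max => /andP[Mn NMn].
  have Mn' : (M < n.+1)%N by [].
  exact: (@leq_bigmax_cond _ (fun i : 'I_n.+1 => (N i <= n)%N) (fun i => i : nat) (Ordinal Mn') NMn).
have m_ok n : (N 0 <= n)%N -> (N (m n) <= n)%N.
  move=> N0; have [|i iP mi] := @eq_bigmax_cond _ [pred i : 'I_n.+1 | (N i <= n)%N] (fun i => i : nat).
    by apply/card_gt0P; exists ord0.
  by rewrite /m mi.
exists m => // eta eta0.
have [M MP] := @eventually_le R (eta^-1); have [N' N'P] := m_large M.
exists (maxn (N 0) N') => n; rewrite geq_max => /andP[/m_ok nN0 /N'P Mm].
have /andP[-> le] := NP (m n) n nN0; apply: le_trans le _.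
rewrite -[leRHS]invrK lef_pV2 ?posrE ?invr_gt0 ?ltr0n //; apply: MP.
exact: leq_trans Mm (leqnSn _).
Qed.

(** With [L = 1 + ln d <= d], cubing gives [M ^+ 3 * L <= d * eps ^+ 3]. If [eps <= 1], the right
    side is at least [d * eps ^+ 2], hence at least [d * eps ^+ 3]. Otherwise it is at least
    [d * eps], which dominates [M * L] by [L <= d] when [eps >= M], and by the cubed bound divided
    by [M ^+ 2] when [eps < M]. *)
Lemma eps_condition (R : realType) (d eps M : R) : 1 <= M -> 1 <= d ->
  M * ((1 + ln d) / d) `^ 3^-1 <= eps ->
  0 < eps /\ M * (1 + ln d) <= 9 * (d * eps * (eps / (8 + eps))).
Proof.
move=> M1 d1 le.
have lnd0 := ln_ge0 d1; have d0 : 0 < d by lra.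
set L := 1 + ln d; have L1 : 1 <= L by rewrite /L; lra.
have Ld : L <= d by apply: le_trans (expR_ge1Dx _) _; rewrite lnK.
have Q0 : 0 < L / d by rewrite divr_gt0 //; lra.
have M0 : 0 < M by lra.
have eps0 : 0 < eps by apply: lt_le_trans le; rewrite mulr_gt0 // powR_gt0.
have cube : M ^+ 3 * L <= d * eps ^+ 3.
  have : (M * (L / d) `^ 3^-1) ^+ 3 <= eps ^+ 3.
    by apply: lerXn2r; rewrite ?nnegrE //; [rewrite mulr_ge0 ?powR_ge0 // |]; apply: ltW.
  rewrite exprMn -(powR_mulrn 3 (powR_ge0 _ _)) -powRrM mulVf ?pnatr_eq0 // powRr1 ?(ltW Q0) //.
  by rewrite mulrA ler_pdivrMr // [eps ^+ 3 * d]mulrC.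
split=> //.
have e8 : 0 < 8 + eps by lra.
have L0 : 0 <= L by lra.
have de0 : 0 <= d * eps by apply: mulr_ge0; apply: ltW.
have MM : M * L <= M ^+ 3 * L.
  apply: ler_wpM2r => //; rewrite -[leLHS]expr1; exact: ler_weXn2l.
rewrite [leRHS]mulrC -[leRHS]mulrA.
have [e1|e1] := leP eps 1.
  apply: (@le_trans _ _ (d * eps * eps)).
    apply: (le_trans MM); apply: (le_trans cube).
    rewrite !exprS expr0 mulr1 mulrA; apply: ler_wpM2l => //.
    by apply: ler_piMr => //; apply: ltW.
  apply: ler_wpM2l => //; rewrite mulrAC ler_pdivlMr //.
  by apply: ler_wpM2l; [exact: ltW | lra].
apply: (@le_trans _ _ (d * eps * 1)); last first.
  by apply: ler_wpM2l => //; rewrite mulrAC ler_pdivlMr //; lra.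
rewrite mulr1; have [Me|eM] := leP M eps.
  by rewrite mulrC; apply: ler_pM => //; apply: ltW.
have M2 : 0 < M ^+ 2 by apply: exprn_gt0.
rewrite -(ler_pM2r M2); apply: (@le_trans _ _ (M ^+ 3 * L)).
  by rewrite (exprS M 2) mulrAC.
apply: le_trans cube _; rewrite exprS mulrA; apply: ler_wpM2l => //.
by apply: lerXn2r; rewrite ?nnegrE; apply: ltW.
Qed.

From mathcomp Require Import all_classical all_reals all_analysis.
Import numFieldNormedType.Exports.
Local Open Scope classical_set_scope.

Theorem theorem4p9 (R : realType) :
  exists C1 C2 : R, [/\ 0 < C1, 0 < C2 &
    forall d lambda eps : R,
      1 <= d -> `|lambda| <= Num.sqrt d ->
      C1 * ((C2 + ln d) / d) `^ (3^-1) <= eps ->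
      exists Delta : nat -> R,
        Delta =o_\oo (fun n : nat => ln (n%:R : R)) /\
        sbm_pr d lambda (@good_decomposition R n d eps (Delta n))
          @[n --> \oo] --> (1 : R)].
Proof.
(* 36 ^ 4 exceeds 250 * 4 * 176 * 9; large literals are unary and overflow. *)
exists (36 ^+ 4), 1; split; rewrite ?exprn_gt0 // => d lambda eps d1 ld le.
have [eps0 large] := eps_condition (exprn_ege1 4 (ler1n R 36)) d1 le.
have {}large : 250 * (1 + ln d) <= eps / (8 + eps) / 4 * (eps * d / 176).
  have := ln_ge0 d1; move: large; rewrite (mulrC d eps); set x := eps / _; set y := eps * d; lra.
pose delta m : R := m.+1%:R^-1.
have delta0 m : 0 < delta m by rewrite invr_gt0 ltr0n.
have nu0 : 0 < eps / 8 by lra.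
pose f m n := sbm_pr d lambda (fun G : graph 'I_n => ~ good_decomposition d eps (delta m * ln n%:R) G).
have fP m (eta : R) : 0 < eta -> exists N, forall n, (N <= n)%N -> 0 <= f m n <= eta.
  apply: (negligible_sbm_pr d1 ld nu0).
  exact: (good_decomposition_negligible d1 ld eps0 large (delta0 m)).
have [m m_large fm] := diagonal_sequence fP.
(* The ratio of this sequence to [ln n%:R] is [(m n).+1%:R^-1], which tends to 0. *)
exists (fun n => delta (m n) * ln n%:R); split.
  apply/eqoP => e e0; have [M MP] := @eventually_le R (e^-1).
  have [N NP] := m_large M; exists N => // n /= /NP Mm.
  rewrite normrM; apply: ler_wpM2r => //; rewrite gtr0_norm // /delta.
  rewrite -[leRHS]invrK lef_pV2 ?posrE ?invr_gt0 ?ltr0n //; apply: MP.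
  exact: leq_trans Mm (leqnSn _).
apply/cvgrPdist_le => e e0; have [N NP] := fm e e0; exists N => // n /= /NP /andP[f0 fe].
by rewrite sbm_prC opprB addrC subrK ger0_norm.
Qed.
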